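(* For any $2\le n\le\infty$, there exists an essentially finitely correlated state on $\mathcal{O}_n$ which is not finitely correlated.
   Context: For $2\le n\le\infty$, $\mathcal{O}_n$ is the Cuntz algebra with Cuntz generators $s_1,\ldots,s_n$ (a sequence $s_1,s_2,\ldots$ if $n=\infty$): the universal unital C*-algebra generated by elements with $s_i^*s_j=\delta_{ij}I$ and $\sum_{i=1}^n s_is_i^*=I$ if $n<\infty$, respectively $\sum_{i=1}^k s_is_i^*\le I$ for all $k\geq 1$ if $n=\infty$. When $n=\infty$, $\{1,\ldots,n\}$ means $\{1,2,\ldots\}$. Let $\mathcal{I}_n=\bigcup_{l\ge0}\{1,\ldots,n\}^l$ be the set of finite words, $\{1,\ldots,n\}^0=\{\emptyset\}$, $s_J=s_{j_1}\cdots s_{j_l}$ for $J=(j_1,\ldots,j_l)$, $s_\emptyset=I$. For states $\omega,\omega'$ on $\mathcal{O}_n$, write $\omega\sim\omega'$ if their GNS representations are unitarily equivalent. For a state $\omega$ with GNS representation $(\mathcal{H},\pi,\Omega)$, let $\mathcal{K}(\omega)$ be the closed linear span of $\{\pi(s_J)^*\Omega: J\in\mathcal{I}_n\}$ in $\mathcal{H}$, $\mathrm{c}\dim\omega:=\dim\mathcal{K}(\omega)\in\{1,2,\ldots,\infty\}$ (Hilbert space dimension), and $\kappa(\omega):=\min\{\mathrm{c}\dim\omega':\omega'\text{ a state on }\mathcal{O}_n,\ \omega'\sim\omega\}$. A state $\omega$ is finitely correlated if $\mathrm{c}\dim\omega<\infty$, and essentially finitely correlated if $\kappa(\omega)<\infty$.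 *)

(* Defs.v *)
From HB Require Import structures.
From mathcomp Require Import all_boot all_order all_algebra.
From mathcomp Require Import all_classical all_reals all_analysis.
From mathcomp Require Import complex.

Set Implicit Arguments.
Unset Strict Implicit.
Unset Printing Implicit Defensive.
Import Order.TTheory GRing.Theory Num.Theory.
Import numFieldNormedType.Exports.

Local Open Scope classical_set_scope.
Local Open Scope complex_scope.
Local Open Scope ring_scope.

(* Norms on modules over [R[i]] take their values in [R[i]]; there [0 <= z]
   means that [z] is real and nonnegative. *)

(** Hilbert spaces *)

(* The inner product is linear in its first argument. *)
HB.mixin Record isHilbert (R : realType) H of CompleteNormedModule R[i] H := {
  inner : H -> H -> R[i];
  innerDl : forall x y z : H, inner (x + y) z = inner x z + inner y z;
  innerZl : forall (c : R[i]) (x y : H), inner (c *: x) y = c * inner x y;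
  inner_conj : forall x y : H, inner y x = Num.conj (inner x y);
  inner_norm : forall x : H, inner x x = `|x| ^+ 2
}.

#[short(type="hilbertType")]
HB.structure Definition Hilbert (R : realType) :=
  {H of CompleteNormedModule R[i] H & isHilbert R H}.

(** Unital C*-algebras, nonzero by the [nzRingType] convention *)

(* The norm is carried explicitly, with values in [R]: joining algebras with
   [completeNormedModType] is a missing join in the hierarchy, because of
   [numDomainType]. *)
HB.mixin Record isCStar (R : realType) A
    of GRing.NzRing A & GRing.Algebra R[i] A := {
  cnorm : A -> R;
  star : A -> A;
  cnorm_triangle : forall a b : A, cnorm (a + b) <= cnorm a + cnorm b;
  cnormZ : forall (c : R[i]) (a : A),
    (cnorm (c *: a))%:C = `|c| * (cnorm a)%:C;
  cnorm_eq0 : forall a : A, cnorm a = 0 -> a = 0;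
  cnormM : forall a b : A, cnorm (a * b) <= cnorm a * cnorm b;
  cnorm_complete : forall u : nat -> A,
    (forall e : R, 0 < e -> exists N : nat, forall m n : nat,
       (N <= m)%N -> (N <= n)%N -> cnorm (u m - u n) < e) ->
    exists l : A, forall e : R, 0 < e -> exists N : nat, forall n : nat,
      (N <= n)%N -> cnorm (u n - l) < e;
  starK : involutive star;
  starD : forall a b : A, star (a + b) = star a + star b;
  starZ : forall (c : R[i]) (a : A), star (c *: a) = Num.conj c *: star a;
  starM : forall a b : A, star (a * b) = star b * star a;
  cnorm_star : forall a : A, cnorm (star a * a) = cnorm a ^+ 2
}.

#[short(type="cstarType")]
HB.structure Definition CStar (R : realType) :=
  {A of GRing.NzRing A & GRing.Algebra R[i] A & isCStar R A}.

Section CuntzAlgebra.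
Variable R : realType.

Definition cstar_le (A : cstarType R) (a b : A) : Prop :=
  exists c : A, b - a = star c * c.

(* [Some m] stands for the finite number [m] and [None] for infinity;
   generators are indexed from 0. *)
Definition cuntz_index (n : option nat) : eqType :=
  if n is Some m then 'I_m else nat.

Definition cuntz_complete (n : option nat) (A : cstarType R) :
    (cuntz_index n -> A) -> Prop :=
  match n return (cuntz_index n -> A) -> Prop with
  | Some m => fun s => \sum_(i < m) s i * star (s i) = 1
  | None => fun s => forall k : nat,
      cstar_le (\sum_(i < k) s i * star (s i)) 1
  end.

Definition cuntz_relations (n : option nat) (A : cstarType R)
    (s : cuntz_index n -> A) : Prop :=
  (forall i j, star (s i) * s j = (i == j)%:R) /\ cuntz_complete s.

Definition cstar_generated (I : Type) (A : cstarType R) (s : I -> A) : Prop :=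
  forall B : set A,
    (forall a, (forall e : R, 0 < e -> exists2 b, B b & cnorm (a - b) < e) ->
       B a) ->
    B 1 ->
    (forall a b, B a -> B b -> B (a + b)) ->
    (forall (c : R[i]) a, B a -> B (c *: a)) ->
    (forall a b, B a -> B b -> B (a * b)) ->
    (forall a, B a -> B (star a)) ->
    (forall i, B (s i)) ->
  B = setT.

(* Uniqueness of the morphism [f] follows from generation. *)
Definition is_cuntz_algebra (n : option nat) (A : cstarType R)
    (s : cuntz_index n -> A) : Prop :=
  [/\ cuntz_relations s,
      cstar_generated s &
      forall (B : cstarType R) (t : cuntz_index n -> B), cuntz_relations t ->
        exists f : {lrmorphism A -> B},
          (forall a, f (star a) = star (f a)) /\ (forall i, f (s i) = t i)].

Definition word_prod (I : Type) (A : cstarType R) (s : I -> A) (J : seq I) : A :=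
  \prod_(j <- J) s j.

End CuntzAlgebra.

Section States.
Variables (R : realType) (A : cstarType R).

Record state := State {
  state_fun :> {scalar A};
  state_ge0 : forall a : A, 0 <= state_fun (star a * a);
  state1 : state_fun 1 = 1
}.

Record representation (H : hilbertType R) := Representation {
  rep_op :> A -> {linear H -> H};
  rep_continuous : forall a, continuous (rep_op a);
  repD : forall a b x, rep_op (a + b) x = rep_op a x + rep_op b x;
  repZ : forall (c : R[i]) a x, rep_op (c *: a) x = c *: rep_op a x;
  repM : forall a b x, rep_op (a * b) x = rep_op a (rep_op b x);
  rep1 : forall x, rep_op 1 x = x;
  rep_star : forall a x y, inner (rep_op (star a) x) y = inner x (rep_op a y)
}.

(* A GNS triple (H, pi, Omega), unique up to unitary equivalence. *)
Record gns (omega : state) := Gns {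
  gns_space : hilbertType R;
  gns_rep : representation gns_space;
  gns_vector : gns_space;
  gns_state : forall a, omega a = inner (gns_rep a gns_vector) gns_vector;
  gns_cyclic : dense (range (fun a => gns_rep a gns_vector))
}.

Definition unitarily_equivalent (H1 H2 : hilbertType R)
    (pi1 : representation H1) (pi2 : representation H2) : Prop :=
  exists U : {linear H1 -> H2},
    [/\ set_surj setT setT U,
        forall x y, inner (U x) (U y) = inner x y &
        forall a x, U (pi1 a x) = pi2 a (U x)].

Definition state_equiv (omega omega' : state) : Prop :=
  exists (G : gns omega) (G' : gns omega'),
    unitarily_equivalent (gns_rep G) (gns_rep G').

End States.

Section Dimension.
Variables (R : realType) (H : hilbertType R).

Definition linear_span (S : set H) : set H :=
  [set x | exists (m : nat) (c : 'I_m -> R[i]) (v : 'I_m -> H),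
    (forall i, S (v i)) /\ x = \sum_(i < m) c i *: v i].

Definition closed_span (S : set H) : set H := closure (linear_span S).

Definition orthonormal_basis (V E : set H) : Prop :=
  [/\ E `<=` V,
      forall x y, E x -> E y -> inner x y = (x == y)%:R &
      closed_span E = V].

(* Hilbert space dimension of a closed subspace [V], all infinite cardinals
   being identified with [+oo]. [xget] picks the number of elements of an
   orthonormal basis, which does not depend on the basis. *)
Definition hilbert_dim (V : set H) : \bar R :=
  xget +oo%E [set d : \bar R | exists2 E, orthonormal_basis V E & d = counting E].

End Dimension.

Section Correlation.
Variables (R : realType) (I : Type) (A : cstarType R) (s : I -> A).

Definition corr_space (omega : state A) (G : gns omega) : set (gns_space G) :=
  closed_span
    (range (fun J : seq I => gns_rep G (star (word_prod s J)) (gns_vector G))).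
Arguments corr_space {omega} G.

(* The value does not depend on the GNS triple [G]. *)
Definition cdim (omega : state A) : \bar R :=
  xget +oo%E [set d | exists G : gns omega, d = hilbert_dim (corr_space G)].

(* An infimum of values in {1, 2, ..., +oo}, hence a minimum. *)
Definition kappa (omega : state A) : \bar R :=
  ereal_inf [set d | exists2 omega', state_equiv omega' omega & d = cdim omega'].

Definition finitely_correlated (omega : state A) : Prop :=
  (cdim omega < +oo)%E.

Definition essentially_finitely_correlated (omega : state A) : Prop :=
  (kappa omega < +oo)%E.

End Correlation.

Arguments corr_space {R I A} s {omega} G.

(* Main.v *)
Require Import Defs.
From HB Require Import structures.
From mathcomp Require Import all_boot all_order all_algebra.
From mathcomp Require Import all_classical all_reals all_analysis.
From mathcomp Require Import complex ring zify.

Set Implicit Arguments.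
Unset Strict Implicit.
Unset Printing Implicit Defensive.
Import Order.TTheory GRing.Theory Num.Theory.
Import numFieldNormedType.Exports.

Local Open Scope classical_set_scope.
Local Open Scope complex_scope.
Local Open Scope ring_scope.

(** Let the Cuntz algebra act on the square-summable sequences indexed by the
    naturals through isometries that permute the standard basis
    e_0, e_1, e_2 and so on: s_i e_k = e_{b(i,k)}, where b is a bijection from
    letters times naturals onto the naturals, increasing in k, with
    b(z,0) = 0 for one letter z and k < b(i,k) whenever b(i,k) is not 0
    (branching).  For m letters take b(i,k) = k m + i, and for infinitely many
    take b(i,k) = 2^i (2k+1) - 1.

    The vector e_0 is cyclic, because b moves every other node strictly away
    from 0, so that each e_y is s_J e_0 for some word J.  Each s_J^* sends e_0
    to e_0 or to 0, so the vector state of e_0 has correlation dimension one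
    (cdim_eigenvector).

    Any other cyclic unit vector gives an equivalent state, and the correlation
    space of its state can be made infinite-dimensional: fix a second letter o,
    let w_k = o...o (k letters) send node 0 to node a_k, and superpose, with
    summable nonzero weights, the vectors s_{w_k} s_z e_{a_k} (spread).  The
    ranges of the isometries s_{w_k} s_z are orthogonal, so (s_{w_k} s_z)^*
    singles out the k-th term and returns a nonzero multiple of e_{a_k}.  The
    correlation space therefore contains an infinite orthonormal sequence
    (cdim_infinite), while k = 0 returns e_0 up to a scalar, which makes the
    vector cyclic.

    Correlation dimension is defined through an arbitrary GNS triple.  The inner
    products of the vectors pi(a) Omega in such a triple are determined by the
    state (gns_vector_inner), so both computations carry over from the concrete
    vectors.  An orthonormal family in the closed span of m orthonormal vectors
    has at most m elements (orthonormal_card), which bounds the size of every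
    possible orthonormal basis.

    To let the universal property produce the representation, the bounded
    operators on the sequence space have to be a C*-algebra.  Operators are
    carried as pairs of mutually adjoint maps (boundedop), so that adjoints come
    without the Riesz representation theorem. *)

(** * Positive definite forms and Hilbert spaces *)

Section InnerProductSpace.
Variables (C : numClosedFieldType) (U : lmodType C) (h : U -> U -> C).
Hypothesis hDl : forall x y z, h (x + y) z = h x z + h y z.
Hypothesis hZl : forall c x y, h (c *: x) y = c * h x y.
Hypothesis h_conj : forall x y, h y x = Num.conj (h x y).
Hypothesis h_ge0 : forall x, 0 <= h x x.
Hypothesis h_eq0 : forall x, h x x = 0 -> x = 0.

Let hDr x y z : h z (x + y) = h z x + h z y.
Proof. by rewrite h_conj hDl rmorphD /= -!h_conj. Qed.

Let hZr c x y : h y (c *: x) = Num.conj c * h y x.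
Proof. by rewrite h_conj hZl rmorphM /= -h_conj. Qed.

Lemma cauchy_schwarz x y : `|h x y| ^+ 2 <= h x x * h y y.
Proof.
have [/eqP hyy0|hyy0] := boolP (h y y == 0).
  have -> : y = 0 by exact: h_eq0.
  have -> : h x 0 = 0 by rewrite -(scale0r 0) hZr conjC0 mul0r.
  by rewrite normr0 expr0n mulr_ge0.
have hyy : 0 < h y y by rewrite lt0r hyy0 h_ge0.
pose a := h x y / h y y.
(* the component of x orthogonal to y has nonnegative square norm *)
have : 0 <= h (x + (- a) *: y) (x + (- a) *: y) by exact: h_ge0.
have -> : h (x + - a *: y) (x + - a *: y) = h x x - `|h x y| ^+ 2 / h y y.
  rewrite hDl !hDr !hZl !hZr !rmorphN /a rmorphM fmorphV normCK /=.
  have -> : Num.conj (h y y) = h y y by rewrite -h_conj.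
  rewrite [h y x]h_conj; move: hyy0.
  move: (h x x) (h x y) (Num.conj (h x y)) (h y y) => p u v w w0; by field.
by rewrite subr_ge0 ler_pdivrMr.
Qed.

(** Expanding the square of the left side leaves twice the real part of h x y,
    which Cauchy-Schwarz bounds. *)
Lemma sqrtC_triangle x y :
  sqrtC (h (x + y) (x + y)) <= sqrtC (h x x) + sqrtC (h y y).
Proof.
rewrite -ler_sqr ?nnegrE ?addr_ge0 ?sqrtC_ge0 // sqrrD !sqrtCK.
rewrite hDl !hDr addrA -addrA -addrA -addrA lerD2l addrA lerD2r.
rewrite [h y x]h_conj -mulr_natr.
have -> : h x y + Num.conj (h x y) = 'Re (h x y) * 2.
  by rewrite ReE mulfVK // pnatr_eq0.
rewrite ler_pM2r ?ltr0n //.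
have [+ _] := leif_Re_Creal (h x y) => /le_trans; apply.
rewrite -ler_sqr ?nnegrE ?mulr_ge0 ?sqrtC_ge0 // exprMn !sqrtCK.
exact: cauchy_schwarz.
Qed.
End InnerProductSpace.

Lemma Re_normD (R : realType) (a b : R[i]) :
  complex.Re `|a + b| <= complex.Re `|a| + complex.Re `|b|.
Proof. by have := ler_normD a b; rewrite lecE => /andP[_]; rewrite raddfD. Qed.

Section HilbertTheory.
Variables (R : realType) (H : hilbertType R).
Implicit Types (x y z : H) (c : R[i]).

Lemma innerDr x y z : inner z (x + y) = inner z x + inner z y.
Proof. by rewrite inner_conj innerDl rmorphD /= -!inner_conj. Qed.

Lemma innerZr c x y : inner y (c *: x) = Num.conj c * inner y x.
Proof. by rewrite inner_conj innerZl rmorphM /= -inner_conj. Qed.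

Lemma inner0l x : inner 0 x = 0.
Proof. by rewrite -(scale0r 0) innerZl mul0r. Qed.

Lemma inner0r x : inner x 0 = 0.
Proof. by rewrite inner_conj inner0l conjC0. Qed.

Lemma innerNl x y : inner (- x) y = - inner x y.
Proof. by rewrite -scaleN1r innerZl mulN1r. Qed.

Lemma innerBl x y z : inner (x - y) z = inner x z - inner y z.
Proof. by rewrite innerDl innerNl. Qed.

Lemma innerBr x y z : inner z (x - y) = inner z x - inner z y.
Proof. by rewrite inner_conj innerBl rmorphB /= -!inner_conj. Qed.

Lemma inner_suml (I : Type) (r : seq I) (P : pred I) (F : I -> H) y :
  inner (\sum_(i <- r | P i) F i) y = \sum_(i <- r | P i) inner (F i) y.
Proof.
by apply: (big_morph (fun x => inner x y) (fun x z => innerDl x z y) (inner0l y)).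
Qed.

Lemma inner_eq0 x : inner x x = 0 -> x = 0.
Proof. by rewrite inner_norm => /eqP; rewrite sqrf_eq0 normr_eq0 => /eqP. Qed.

Lemma inner_inj x y : (forall z, inner x z = inner y z) -> x = y.
Proof.
move=> exy; apply/eqP; rewrite -subr_eq0; apply/eqP/inner_eq0.
by rewrite innerBl exy subrr.
Qed.

Lemma inner_cauchy_schwarz x y : `|inner x y| <= `|x| * `|y|.
Proof.
rewrite -ler_sqr ?nnegrE ?mulr_ge0 // exprMn -!inner_norm.
apply: (cauchy_schwarz (h := @inner R H)).
- exact: innerDl.
- exact: innerZl.
- exact: inner_conj.
- by move=> z; rewrite inner_norm exprn_ge0.
- exact: inner_eq0.
Qed.

(** The norm of a complex normed module is a complex number; estimates are made
    with this real version of it. *)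
Definition rnorm x : R := complex.Re `|x|.

Lemma rnormE x : `|x| = (rnorm x)%:C.
Proof. by rewrite /rnorm RRe_real // normr_real. Qed.

Lemma rnorm_ge0 x : 0 <= rnorm x.
Proof. by rewrite -ler0c -rnormE. Qed.

Lemma rnorm_triangle x y : rnorm (x + y) <= rnorm x + rnorm y.
Proof. by rewrite -lecR rmorphD /= -!rnormE ler_normD. Qed.

Lemma rnorm_eq0 x : rnorm x = 0 -> x = 0.
Proof. by move=> x0; apply/eqP; rewrite -normr_eq0 rnormE x0 rmorph0. Qed.

Lemma rnorm0 : rnorm 0 = 0.
Proof. by rewrite /rnorm normr0. Qed.

Lemma rnormN x : rnorm (- x) = rnorm x.
Proof. by rewrite /rnorm normrN. Qed.

Lemma rnormB x y : rnorm (x - y) = rnorm (y - x).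
Proof. by rewrite /rnorm distrC. Qed.

Lemma rnormZ c x : rnorm (c *: x) = complex.Re `|c| * rnorm x.
Proof.
have cE : (complex.Re `|c|)%:C = `|c| by rewrite RRe_real // normr_real.
by apply: complexI; rewrite rmorphM /= cE -!rnormE normrZ.
Qed.

Lemma inner_rnorm x : inner x x = (rnorm x ^+ 2)%:C.
Proof. by rewrite inner_norm rnormE rmorphXn. Qed.

Lemma rnorm_unit x : inner x x = 1 -> rnorm x = 1.
Proof.
rewrite inner_rnorm => /complexI/eqP; rewrite sqrf_eq1 => /orP[/eqP //|/eqP x1].
by have := rnorm_ge0 x; rewrite x1 oppr_ge0 ler10.
Qed.

Lemma inner_cauchy_schwarz_rnorm x y : complex.Re `|inner x y| <= rnorm x * rnorm y.
Proof.
rewrite -lecR [X in X <= _]RRe_real ?normr_real //.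
by rewrite rmorphM /= -!rnormE inner_cauchy_schwarz.
Qed.

Lemma rnorm_le_eq0 x : (forall e : R, 0 < e -> rnorm x <= e) -> x = 0.
Proof.
move=> xe; apply: rnorm_eq0; apply/eqP; rewrite eq_le rnorm_ge0 andbT.
by apply/ler_addgt0Pr => e e0; rewrite add0r xe.
Qed.

Lemma closure_rnorm (S : set H) x (e : R) :
  closure S x -> 0 < e -> exists2 y, S y & rnorm (x - y) < e.
Proof.
move=> Sx e0; have e0' : 0 < e%:C by rewrite -(ltcR 0 e) in e0.
have [y [Sy xy]] := Sx _ (nbhsx_ballx x _ e0').
exists y => //; move: xy; rewrite -ball_normE /=.
by rewrite rnormE ltcR.
Qed.

Lemma dense_rnorm (S : set H) :
  (forall x (e : R), 0 < e -> exists2 y, S y & rnorm (x - y) < e) -> dense S.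
Proof.
move=> Sd O [x Ox] Oo.
have /nbhs_ballP[e /= e0 xeO] : nbhs x O by apply: open_nbhs_nbhs.
have er : (complex.Re e)%:C = e by rewrite RRe_real // gtr0_real.
have [|y Sy xy] := Sd x (complex.Re e); first by rewrite -ltcR er.
exists y; split => //; apply: xeO.
by rewrite -ball_normE /= rnormE -er ltcR.
Qed.

Lemma seq_complete (u : nat -> H) :
  (forall e : R, 0 < e -> exists N, forall m n, (N <= m)%N -> (N <= n)%N ->
     rnorm (u m - u n) < e) ->
  exists l, forall e : R, 0 < e -> exists N, forall n, (N <= n)%N ->
     rnorm (u n - l) < e.
Proof.
move=> uC; have : cvg (u @ \oo).
  apply: cauchy_cvg; apply/cauchy_exP => e e0.
  have er : (complex.Re e)%:C = e by rewrite RRe_real // gtr0_real.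
  have [|N uN] := uC (complex.Re e); first by rewrite -ltcR er.
  exists (u N); exists N => // n /= Nn.
  by rewrite -ball_normE /= rnormE -er ltcR; apply: uN.
move=> /cvgrPdist_lt ul; exists (lim (u @ \oo)) => e e0.
have /ul[N _ uN] : 0 < e%:C by rewrite (ltcR 0 e).
exists N => n Nn; rewrite rnormB -ltcR -rnormE.
exact: (uN n Nn).
Qed.

End HilbertTheory.

(** * Orthonormal families and Hilbert dimension *)

Section Orthonormal.
Variables (R : realType) (H : hilbertType R).
Implicit Types (x y : H).

Definition orthonormal_family (I : eqType) (e : I -> H) :=
  forall i j, inner (e i) (e j) = (i == j)%:R.

(** The finite sum P of rank-one projections fixes the linear span and is bounded
    by m times the norm, so x - P x is small as soon as x is near the span. *)
Lemma orthonormal_expansion m (e : 'I_m -> H) x :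
  orthonormal_family e -> closed_span (range e) x ->
  x = \sum_(i < m) inner x (e i) *: e i.
Proof.
move=> oe ex; pose P z := \sum_(i < m) inner z (e i) *: e i.
have PB y z : P (y - z) = P y - P z.
  rewrite /P -sumrB; apply: eq_bigr => i _.
  by rewrite innerBl scalerBl.
have Pe i : P (e i) = e i.
  rewrite /P (bigD1 i) //= oe eqxx scale1r big1 ?addr0 // => j ji.
  by rewrite oe eq_sym (negbTE ji) scale0r.
have Pspan y : linear_span (range e) y -> P y = y.
  move=> [k [c [v [ve ->]]]].
  transitivity (\sum_(i < k) c i *: P (v i)).
    rewrite /P; under [RHS]eq_bigr do rewrite scaler_sumr.
    rewrite exchange_big /=; apply: eq_bigr => i _.
    rewrite inner_suml scaler_suml; apply: eq_bigr => j _.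
    by rewrite innerZl scalerA.
  by apply: eq_bigr => i _; have [j _ <-] := ve i; rewrite Pe.
have Pnorm z : rnorm (P z) <= rnorm z *+ m.
  rewrite /P -[X in _ *+ X]card_ord -sumr_const.
  elim/big_ind2 : _ => [|a b c d ab cd|i _].
  - by rewrite rnorm0.
  - by rewrite (le_trans (rnorm_triangle _ _)) // lerD.
  - have ei1 : rnorm (e i) = 1 by apply: rnorm_unit; rewrite oe eqxx.
    by rewrite rnormZ ei1 mulr1 (le_trans (inner_cauchy_schwarz_rnorm _ _)) // ei1 mulr1.
apply/eqP; rewrite -subr_eq0; apply/eqP/rnorm_le_eq0 => d d0.
have m0 : 0 < m.+1%:R :> R by rewrite ltr0n.
have [|y ys xy] := closure_rnorm ex (e := d / m.+1%:R).
  by rewrite divr_gt0.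
rewrite -/(P x) (_ : x - P x = (x - y) - P (x - y)); last first.
  by rewrite PB (Pspan _ ys) opprB addrA subrK.
rewrite (le_trans (rnorm_triangle _ _)) //.
rewrite rnormN (le_trans (lerD (lexx _) (Pnorm _))) // -mulrS.
by rewrite -mulr_natr -ler_pdivlMr // ltW.
Qed.

(** The expansions write the p x p Gram matrix of f, an identity matrix, as a
    product through dimension m; its rank forces p <= m. *)
Lemma orthonormal_card m p (e : 'I_m -> H) (f : 'I_p -> H) :
  orthonormal_family e -> orthonormal_family f ->
  (forall j, closed_span (range e) (f j)) -> (p <= m)%N.
Proof.
move=> oe of_ fe.
pose A : 'M[R[i]]_(p, m) := \matrix_(j, i) inner (f j) (e i).
pose B : 'M[R[i]]_(m, p) := \matrix_(i, j) inner (e i) (f j).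
apply: (@mulmx1_min _ _ _ A B); apply/matrixP => j k; rewrite !mxE.
rewrite -of_ [X in _ = inner X _](orthonormal_expansion oe (fe j)) inner_suml.
by apply: eq_bigr => i _; rewrite !mxE innerZl.
Qed.

Lemma finite_basis_bound (V E : set H) :
  orthonormal_basis V E -> finite_set E ->
  exists m, forall p (f : 'I_p -> H),
    orthonormal_family f -> (forall j, V (f j)) -> (p <= m)%N.
Proof.
move=> [EV oE <-] /finite_seqP[s Es].
pose t := undup s; pose e (i : 'I_(size t)) := nth 0 t i.
have eE : range e = E.
  rewrite Es; apply/seteqP; split => [_ [i _ <-]|x /= xs].
    by rewrite /= -mem_undup mem_nth.
  have xt : (index x t < size t)%N by rewrite index_mem mem_undup.
  by exists (Ordinal xt) => //; rewrite /e nth_index // mem_undup.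
exists (size t) => p f of_ fE; apply: (@orthonormal_card _ _ e f) => //.
  move=> i j; rewrite oE ?/e ?nth_uniq ?undup_uniq //; rewrite -eE.
    by exists i.
  by exists j.
by move=> j; rewrite eE.
Qed.

(** Every orthonormal basis is infinite, whichever one the definition picks; if
    there were none, the default value would be infinite as well. *)
Lemma hilbert_dim_infinite (V : set H) (f : nat -> H) :
  orthonormal_family f -> (forall k, V (f k)) -> hilbert_dim V = +oo%E.
Proof.
move=> of_ fV; rewrite /hilbert_dim; case: xgetP => // d _ [E bE ->].
have [Ef|Ei] := pselect (finite_set E); last by rewrite /counting asboolF.
have [m mP] := finite_basis_bound bE Ef.
suff: (m.+1 <= m)%N by rewrite ltnn.
by apply: (mP m.+1 (fun i => f i)) => // i j; rewrite of_.
Qed.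

(** Since w is a basis, the value picked is the size of some basis; two distinct
    members of a basis would be two orthonormal vectors on a line. *)
Lemma hilbert_dim_line (S : set H) (w : H) :
  inner w w = 1 -> S w -> (forall v, S v -> exists c, v = c *: w) ->
  (hilbert_dim (closed_span S) < +oo)%E.
Proof.
move=> w1 Sw Sline; pose e (i : 'I_1) := w.
have oe : orthonormal_family e by move=> i j; rewrite !ord1 eqxx.
have eS : closed_span (range e) = closed_span S.
  congr closure; apply/seteqP; split => x [k [c [v [vS ->]]]].
    by exists k, c, v; split => // i; have [j _ <-] := vS i.
  have /choice[d vd] : forall i, exists d, v i = d *: w by move=> i; apply: Sline.
  exists k, (fun i => c i * d i), (fun=> w); split; first by move=> i; exists ord0.
  by apply: eq_bigr => i _; rewrite vd scalerA.
have bw : orthonormal_basis (closed_span S) [set w].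
  split.
  - by move=> _ ->; apply: subset_closure; exists 1%N, (fun=> 1), (fun=> w);
      rewrite big_ord1 scale1r.
  - by move=> x y -> ->; rewrite eqxx.
  - rewrite -eS; congr closed_span.
    by apply/seteqP; split => [x ->|x [i _ <-] //]; exists ord0.
rewrite /hilbert_dim; case: xgetP => [d _ [E bE ->]|/(_ (counting [set w]))]; last first.
  by move=> []; exists [set w].
have [Ef|/infiniteP/pcard_leP[g]] := pselect (finite_set E).
  by rewrite /counting asboolT // ltry.
have [EV oE _] := bE.
have gE k : E (g k) by apply: funS.
suff : (2 <= 1)%N by [].
apply: (orthonormal_card (f := fun i : 'I_2 => g i) oe) => [i j|j].
  rewrite oE //; congr (_%:R); congr nat_of_bool.
  apply/eqP/eqP => [gij|-> //]; apply: val_inj.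
  by apply: (@inj _ _ _ g) gij; rewrite inE.
by rewrite eS; apply: EV.
Qed.

End Orthonormal.

(** * Square-summable complex sequences *)

Section ComplexSequences.
Variable R : realType.
Implicit Types (z w c l m : R[i]) (u v : nat -> R[i]).

(** The squared modulus, as a real number. *)
Definition sqc z : R := complex.Re z ^+ 2 + complex.Im z ^+ 2.

Lemma sqc_ge0 z : 0 <= sqc z.
Proof. by rewrite addr_ge0 // sqr_ge0. Qed.

Lemma normC_sqc z : `|z| ^+ 2 = (sqc z)%:C.
Proof.
case: z => a b; rewrite normc_def /= -rmorphXn /= sqr_sqrtr //.
by rewrite addr_ge0 // sqr_ge0.
Qed.

Lemma mul_conj_sqc z : z * Num.conj z = (sqc z)%:C.
Proof. by rewrite -normCK normC_sqc. Qed.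

Lemma sqc_eq0 z : sqc z = 0 -> z = 0.
Proof.
by move=> z0; apply/eqP; rewrite -normr_eq0 -sqrf_eq0 normC_sqc z0.
Qed.

Lemma sqcM z w : sqc (z * w) = sqc z * sqc w.
Proof. by apply: complexI; rewrite rmorphM /= -!normC_sqc normrM exprMn. Qed.

Lemma sqcD_le z w : sqc (z + w) <= 2 * (sqc z + sqc w).
Proof.
case: z => a b; case: w => c d; rewrite /sqc /= -subr_ge0.
rewrite (_ : _ - _ = (a - c) ^+ 2 + (b - d) ^+ 2); last by ring.
by rewrite addr_ge0 // sqr_ge0.
Qed.

Lemma norm_i : `|'i%C : R[i]| = 1.
Proof. by rewrite normc_def /= expr0n expr1n add0r sqrtr1. Qed.

Lemma Re_le_norm z : `|complex.Re z| <= complex.Re `|z|.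
Proof.
by rewrite -lecR RRe_real ?normr_real // normc_ge_Re.
Qed.

Lemma Im_le_norm z : `|complex.Im z| <= complex.Re `|z|.
Proof.
rewrite -lecR RRe_real ?normr_real //.
have := normc_ge_Re (z * 'i%C); rewrite ReiNIm normrM.
by rewrite normrN norm_i mulr1.
Qed.

(** Through real and imaginary parts, limits and completeness reduce to those of
    the real numbers. *)
Definition ccvg u l :=
  ((fun n => complex.Re (u n)) @ \oo --> (complex.Re l : R)) /\
  ((fun n => complex.Im (u n)) @ \oo --> (complex.Im l : R)).

Definition clim u : R[i] :=
  limn (fun n => complex.Re (u n)) +i* limn (fun n => complex.Im (u n)).

Lemma ccvg_lim u l : ccvg u l -> clim u = l.
Proof.
case: l => a b [ua ub]; rewrite /clim; congr (_ +i* _).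
  exact: cvg_lim ua.
exact: cvg_lim ub.
Qed.

Lemma ccvgD u v l m : ccvg u l -> ccvg v m -> ccvg (fun n => u n + v n) (l + m).
Proof.
move=> [ul ul'] [vm vm']; split.
  under eq_fun do rewrite raddfD; rewrite raddfD; exact: cvgD.
under eq_fun do rewrite raddfD; rewrite raddfD; exact: cvgD.
Qed.

Lemma ccvgM c u l : ccvg u l -> ccvg (fun n => c * u n) (c * l).
Proof.
case: c => a b [ul ul']; rewrite /ccvg.
have ReM w : complex.Re ((a +i* b) * w) = a * complex.Re w - b * complex.Im w.
  by case: w.
have ImM w : complex.Im ((a +i* b) * w) = a * complex.Im w + b * complex.Re w.
  by case: w.
split.
  by under eq_fun do rewrite ReM; rewrite ReM; apply: cvgB; apply: cvgMr.
by under eq_fun do rewrite ImM; rewrite ImM; apply: cvgD; apply: cvgMr.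
Qed.

Lemma ccvg_conj u l : ccvg u l -> ccvg (fun n => Num.conj (u n)) (Num.conj l).
Proof.
have ReJ z : complex.Re (Num.conj z) = complex.Re z by case: z.
have ImJ z : complex.Im (Num.conj z) = - complex.Im z by case: z.
move=> [ul ul']; split.
  by under eq_fun do rewrite ReJ; rewrite ReJ.
by under eq_fun do rewrite ImJ; rewrite ImJ; apply: cvgN.
Qed.

Lemma ccvg_real (a : nat -> R) (l : R) :
  a @ \oo --> l -> ccvg (fun n => (a n)%:C) l%:C.
Proof. by move=> al; split => //=; apply: cvg_cst. Qed.

Lemma ccvg_comp u l (p : nat -> nat) :
  p @ \oo --> \oo -> ccvg u l -> ccvg (fun n => u (p n)) l.
Proof.
by move=> pl [ul ul']; split; [apply: cvg_comp ul|apply: cvg_comp ul'].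
Qed.

Lemma complex_seq_complete u :
  (forall e : R, 0 < e -> exists N, forall m n : nat, (N <= m)%N -> (N <= n)%N ->
     complex.Re `|u m - u n| < e) ->
  exists l, ccvg u l.
Proof.
move=> uC.
have real_cvg (p : R[i] -> R) : (forall z w, p (z - w) = p z - p w) ->
    (forall z, `|p z| <= complex.Re `|z|) -> cvg ((fun n => p (u n)) @ \oo).
  move=> pB ple; apply: cauchy_cvg; apply/cauchy_exP => e /uC[N uN].
  exists (p (u N)); exists N => // n /= Nn.
  by rewrite -ball_normE /= -pB (le_lt_trans (ple _)) // uN.
exists (clim u); split.
  by apply: real_cvg; [exact: raddfB|exact: Re_le_norm].
by apply: real_cvg; [exact: raddfB|exact: Im_le_norm].
Qed.

End ComplexSequences.

Section SquareSummable.
Variable R : realType.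
Implicit Types x y : nat -> R[i].

Definition sqsum x (n : nat) : R := series (fun k => sqc (x k)) n.

Definition square_summable x := exists M : R, forall n, sqsum x n <= M.

Lemma sqsum_nd x : nondecreasing_seq (sqsum x).
Proof.
apply/nondecreasing_seqP => n; rewrite /sqsum [leRHS]seriesSr lerDl; exact: sqc_ge0.
Qed.

Lemma sqsum_cvg x : square_summable x -> cvgn (sqsum x).
Proof.
move=> [M xM]; apply: nondecreasing_is_cvgn; first exact: sqsum_nd.
by exists M => _ [n _ <-].
Qed.

Lemma sqsum_le_lim x n : square_summable x -> sqsum x n <= limn (sqsum x).
Proof.
by move=> xs; apply: nondecreasing_cvgn_le; [exact: sqsum_nd|exact: sqsum_cvg].
Qed.

Lemma lim_sqsum_le x M : (forall n, sqsum x n <= M) -> limn (sqsum x) <= M.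
Proof.
move=> xM; apply: limr_le; last by near=> n.
by apply: sqsum_cvg; exists M.
Unshelve. all: by end_near. Qed.

Lemma square_summableD x y : square_summable x -> square_summable y ->
  square_summable (fun k => x k + y k).
Proof.
move=> [M xM] [N yN]; exists (2 * (M + N)) => n.
apply: (@le_trans _ _ (2 * (sqsum x n + sqsum y n))).
  rewrite /sqsum /series /= -big_split mulr_sumr; apply: ler_sum => k _.
  exact: sqcD_le.
by rewrite ler_pM2l // lerD.
Qed.

Lemma square_summableZ (c : R[i]) x : square_summable x ->
  square_summable (fun k => c * x k).
Proof.
move=> [M xM]; exists (sqc c * M) => n.
rewrite /sqsum /series /=; under eq_bigr do rewrite sqcM.
by rewrite -mulr_sumr ler_wpM2l ?sqc_ge0 //; exact: xM.
Qed.

Lemma square_summable0 : square_summable (fun=> 0).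
Proof.
exists 0 => n; rewrite /sqsum /series /= big1 // => k _.
by rewrite /sqc /= expr0n addr0.
Qed.

Definition dotsum x y (n : nat) : R[i] :=
  series (fun k => x k * Num.conj (y k)) n.

Lemma dotsum_diag x n : dotsum x x n = (sqsum x n)%:C.
Proof.
rewrite /dotsum /sqsum /series /= rmorph_sum /=; apply: eq_bigr => k _.
exact: mul_conj_sqc.
Qed.

(** Real and imaginary parts converge absolutely, since the modulus of each term
    is at most half the sum of the two squared moduli. *)
Lemma dotsum_cvg x y : square_summable x -> square_summable y ->
  ccvg (dotsum x y) (clim (dotsum x y)).
Proof.
move=> xs ys.
have part_cvg (p : {additive R[i] -> R}) :
    (forall z, `|p z| <= complex.Re `|z|) -> cvgn (fun n => p (dotsum x y n)).
  move=> ple.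
  have -> : (fun n => p (dotsum x y n)) =
            series (fun k => p (x k * Num.conj (y k))).
    by apply/funext => n; rewrite /dotsum /series /= raddf_sum.
  apply: normed_cvg.
  apply: (@series_le_cvg _ _ (fun k => sqc (x k) + sqc (y k))) => [k|k|k|].
  - exact: normr_ge0.
  - by rewrite addr_ge0 // sqc_ge0.
  - rewrite (le_trans (ple _)) // -lecR RRe_real ?normr_real //.
    rewrite normrM norm_conjC rmorphD /= -!normC_sqc.
    have : 0 <= (`|x k| - `|y k|) ^+ 2.
      by rewrite real_exprn_even_ge0 // rpredB // normr_real.
    rewrite sqrrB.
    set a := `|x k|; set b := `|y k|.
    rewrite addrAC subr_ge0; apply: le_trans.
    by rewrite mulr2n lerDl mulr_ge0 // normr_ge0.
  - apply: is_cvg_seriesD; exact: sqsum_cvg.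
by split; apply: part_cvg => z; [exact: Re_le_norm|exact: Im_le_norm].
Qed.

End SquareSummable.

(** * The inner product space of square-summable sequences *)

Record ell2 (R : realType) := Ell2 {
  coord :> nat -> R[i];
  coord_summable : square_summable coord
}.

HB.instance Definition _ (R : realType) := gen_eqMixin (ell2 R).
HB.instance Definition _ (R : realType) := gen_choiceMixin (ell2 R).

Section Ell2Module.
Variable R : realType.
Implicit Types (x y z : ell2 R) (c : R[i]).

Lemma ell2_eq x y : coord x =1 coord y -> x = y.
Proof.
case: x y => [x xs] [y ys] /= /funext xy; move: xs ys.
by rewrite xy => xs ys; congr Ell2; exact: Prop_irrelevance.
Qed.

Definition ell2_zero : ell2 R := Ell2 (square_summable0 R).
Definition ell2_add x y :=
  Ell2 (square_summableD (coord_summable x) (coord_summable y)).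
Definition ell2_scale c x := Ell2 (square_summableZ c (coord_summable x)).
Definition ell2_opp x := ell2_scale (-1) x.

Let addA : associative ell2_add.
Proof. by move=> x y z; apply: ell2_eq => k /=; rewrite addrA. Qed.
Let addC : commutative ell2_add.
Proof. by move=> x y; apply: ell2_eq => k /=; rewrite addrC. Qed.
Let add0 : left_id ell2_zero ell2_add.
Proof. by move=> x; apply: ell2_eq => k /=; rewrite add0r. Qed.
Let addN : left_inverse ell2_zero ell2_opp ell2_add.
Proof. by move=> x; apply: ell2_eq => k /=; rewrite mulN1r addNr. Qed.

HB.instance Definition _ := GRing.isZmodule.Build (ell2 R) addA addC add0 addN.

Let scaleA c d x : ell2_scale c (ell2_scale d x) = ell2_scale (c * d) x.
Proof. by apply: ell2_eq => k /=; rewrite mulrA. Qed.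
Let scale1 : left_id 1 ell2_scale.
Proof. by move=> x; apply: ell2_eq => k /=; rewrite mul1r. Qed.
Let scaleDr : right_distributive ell2_scale +%R.
Proof. by move=> c x y; apply: ell2_eq => k /=; rewrite mulrDr. Qed.
Let scaleDl x : {morph ell2_scale^~ x : c d / c + d}.
Proof. by move=> c d; apply: ell2_eq => k /=; rewrite mulrDl. Qed.

HB.instance Definition _ :=
  GRing.Zmodule_isLmodule.Build R[i] (ell2 R) scaleA scale1 scaleDr scaleDl.

Lemma coordD x y k : (x + y) k = x k + y k. Proof. by []. Qed.
Lemma coordZ c x k : (c *: x) k = c * x k. Proof. by []. Qed.
Lemma coord0 k : (0 : ell2 R) k = 0. Proof. by []. Qed.
Lemma coordB x y k : (x - y) k = x k - y k.
Proof. by rewrite coordD; congr (_ + _); rewrite /= mulN1r. Qed.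
Lemma coord_sum (I : Type) (r : seq I) (P : pred I) (F : I -> ell2 R) k :
  (\sum_(i <- r | P i) F i) k = \sum_(i <- r | P i) F i k.
Proof. by apply: (big_morph (fun x => coord x k)). Qed.

Definition ell2_dot x y : R[i] := clim (dotsum x y).

Lemma ell2_dotP x y : ccvg (dotsum x y) (ell2_dot x y).
Proof. by apply: dotsum_cvg; exact: coord_summable. Qed.

Lemma ell2_dotDl x y z : ell2_dot (x + y) z = ell2_dot x z + ell2_dot y z.
Proof.
apply: ccvg_lim.
have -> : dotsum (x + y) z = fun n => dotsum x z n + dotsum y z n.
  apply/funext => n; rewrite /dotsum /series /= -big_split /=.
  by apply: eq_bigr => k _; rewrite mulrDl.
by apply: ccvgD; exact: ell2_dotP.
Qed.

Lemma ell2_dotZl c x y : ell2_dot (c *: x) y = c * ell2_dot x y.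
Proof.
apply: ccvg_lim.
have -> : dotsum (c *: x) y = fun n => c * dotsum x y n.
  apply/funext => n; rewrite /dotsum /series /= mulr_sumr.
  by apply: eq_bigr => k _; rewrite mulrA.
by apply: ccvgM; exact: ell2_dotP.
Qed.

Lemma ell2_dot_conj x y : ell2_dot y x = Num.conj (ell2_dot x y).
Proof.
apply: ccvg_lim.
have -> : dotsum y x = fun n => Num.conj (dotsum x y n).
  apply/funext => n; rewrite /dotsum /series /= rmorph_sum.
  by apply: eq_bigr => k _; rewrite rmorphM /= conjCK mulrC.
by apply: ccvg_conj; exact: ell2_dotP.
Qed.

Lemma ell2_dot_diag x : ell2_dot x x = (limn (sqsum x))%:C.
Proof.
apply: ccvg_lim; rewrite (funext (dotsum_diag x)).
by apply: ccvg_real; apply: sqsum_cvg; exact: coord_summable.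
Qed.

Lemma sqc_coord_le x k : sqc (x k) <= limn (sqsum x).
Proof.
rewrite (le_trans _ (sqsum_le_lim k.+1 (coord_summable x))) //.
rewrite /sqsum [leRHS]seriesSr lerDr; apply: sumr_ge0 => i _.
exact: sqc_ge0.
Qed.

Lemma ell2_dot_ge0 x : 0 <= ell2_dot x x.
Proof.
by rewrite ell2_dot_diag ler0c (le_trans (sqc_ge0 (x 0%N))) // sqc_coord_le.
Qed.

Lemma ell2_dot_eq0 x : ell2_dot x x = 0 -> x = 0.
Proof.
rewrite ell2_dot_diag => /complexI x0; apply: ell2_eq => k.
apply: sqc_eq0; apply/eqP; rewrite eq_le sqc_ge0 andbT -x0.
exact: sqc_coord_le.
Qed.

Definition ell2_norm x := sqrtC (ell2_dot x x).

Let normD x y : ell2_norm (x + y) <= ell2_norm x + ell2_norm y.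
Proof.
apply: sqrtC_triangle.
- exact: ell2_dotDl.
- exact: ell2_dotZl.
- exact: ell2_dot_conj.
- exact: ell2_dot_ge0.
- exact: ell2_dot_eq0.
Qed.

Let normZ c x : ell2_norm (c *: x) = `|c| * ell2_norm x.
Proof.
rewrite /ell2_norm ell2_dotZl ell2_dot_conj ell2_dotZl rmorphM /= mulrA -normCK.
rewrite -ell2_dot_conj sqrtCM ?nnegrE ?exprn_ge0 ?ell2_dot_ge0 //.
by rewrite sqrCK.
Qed.

Let norm_eq0 x : ell2_norm x = 0 -> x = 0.
Proof. by move=> /eqP; rewrite sqrtC_eq0 => /eqP/ell2_dot_eq0. Qed.

HB.instance Definition _ := Lmodule_isNormed.Build R[i] (ell2 R)
  normD normZ norm_eq0.

Lemma ell2_normE x : `|x| ^+ 2 = ell2_dot x x.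
Proof. by rewrite [`|x|]/(ell2_norm x) sqrtCK. Qed.

Lemma ell2_norm_le x (e : R) : 0 <= e ->
  `|x| <= e%:C <-> forall n, sqsum x n <= e ^+ 2.
Proof.
move=> e0.
rewrite -ler_sqr ?nnegrE ?ler0c // ell2_normE ell2_dot_diag -rmorphXn /= lecR.
split => [xe n|]; last exact: lim_sqsum_le.
by rewrite (le_trans _ xe) // sqsum_le_lim //; exact: coord_summable.
Qed.

Lemma coord_le_norm x k : `|x k| <= `|x|.
Proof.
rewrite -ler_sqr ?nnegrE // normC_sqc ell2_normE ell2_dot_diag lecR.
exact: sqc_coord_le.
Qed.

(** The bounds on the finite partial sums pass to the limit coordinate by
    coordinate; this is how norm estimates survive pointwise convergence. *)
Lemma ell2_limit_bound (u : nat -> ell2 R) (l : nat -> R[i]) x (e : R) (N : nat) :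
  0 <= e ->
  (forall k, ccvg (fun n => u n k) (l k)) ->
  (forall n, (N <= n)%N -> `|x - u n| <= e%:C) ->
  forall n, sqsum (fun k => x k - l k) n <= e ^+ 2.
Proof.
move=> e0 ul xu n.
have sq (a : nat -> R) (b c : R) : a m @[m --> \oo] --> b ->
    (c - a m) ^+ 2 @[m --> \oo] --> (c - b) ^+ 2.
  move=> ab; rewrite expr2; under eq_fun do rewrite expr2.
  by apply: cvgM; apply: cvgB => //; apply: cvg_cst.
have cv : sqsum (fun k => x k - u m k) n @[m --> \oo] -->
    sqsum (fun k => x k - l k) n.
  rewrite /sqsum; elim: n => [|n IH].
    under eq_fun do rewrite /series /= big_geq //.
    by rewrite /series /= big_geq //; apply: cvg_cst.
  under eq_fun do rewrite seriesSr.
  rewrite seriesSr; apply: cvgD => //.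
  have [re im] := ul n.
  rewrite /sqc; apply: cvgD.
    under eq_fun do rewrite raddfB; rewrite raddfB.
    exact: sq.
  under eq_fun do rewrite raddfB; rewrite raddfB.
  exact: sq.
rewrite -(cvg_lim _ cv) //; apply: limr_le; first by apply/cvg_ex; eexists; exact: cv.
near=> m.
have /ell2_norm_le : `|x - u m| <= e%:C by apply: xu; near: m; exists N.
move=> /(_ e0 n); congr (_ <= _); congr (series _ n).
by apply/funext => k; rewrite coordB.
Unshelve. all: by end_near. Qed.

End Ell2Module.

(** * Completeness of the sequence space *)

Section Ell2Complete.
Variable R : realType.
Implicit Types (x y z : ell2 R) (c : R[i]).

(** From a Cauchy filter extract centers u n of balls of radius 1/(n+1) in the
    filter.  Their coordinates converge, and ell2_limit_bound turns the estimate
    between the centers into one on the distance to the pointwise limit. *)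
Lemma ell2_complete (F : set_system (ell2 R)) :
  ProperFilter F -> cauchy F -> cvg F.
Proof.
move=> FF /cauchyP Fc.
pose d (n : nat) : R := n.+1%:R^-1.
have d0 n : 0 < d n by rewrite invr_gt0 ltr0n.
have dle m n : (n <= m)%N -> d m <= d n.
  by move=> nm; rewrite lef_pV2 ?posrE ?ltr0n // ler_nat ltnS.
have /choice[u uF] : forall n, exists x : ell2 R, F (ball x (d n)%:C).
  by move=> n; apply: Fc; rewrite (ltcR 0).
have near_u n y : F (ball y (d n)%:C) -> forall m, (n <= m)%N ->
    `|y - u m| <= (d n + d n)%:C.
  move=> yF m nm; have [z []] := @filter_ex _ F _ _ (filterI yF (uF m)).
  rewrite -!ball_normE /= => yz uz.
  rewrite (le_trans (ler_distD z _ _)) // rmorphD /= lerD // ltW //.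
  by rewrite distrC (lt_le_trans uz) // lecR dle.
have small (e : R) : 0 < e -> exists n, d n + d n < e.
  move=> e0; exists (Num.truncn (2 / e)).
  have := truncnS_gt (2 / e).
  rewrite ltr_pdivrMr // mulrC -ltr_pdivrMr ?ltr0n // => h.
  by rewrite -mulr2n -[X in X < _]mulr_natl; exact: h.
have /choice[l ul] : forall k, exists l, ccvg (fun n => u n k) l.
  move=> k; apply: complex_seq_complete => e e0.
  have [n ne] := small _ (divr_gt0 e0 (ltr0n R 2)).
  exists n => p q np nq.
  rewrite -coordB -ltcR RRe_real ?normr_real //.
  rewrite (le_lt_trans (coord_le_norm _ _)) //.
  rewrite (le_lt_trans (ler_distD (u n) _ _)) //.
  apply: (@le_lt_trans _ _ ((d n + d n)%:C + (d n + d n)%:C)).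
    by apply: lerD; rewrite 1?[`|u p - _|]distrC; apply: near_u.
  by rewrite -rmorphD /= ltcR [ltRHS]splitr ltrD.
have bound n y : F (ball y (d n)%:C) ->
    forall N, sqsum (fun k => y k - l k) N <= (d n + d n) ^+ 2.
  move=> yF; apply: (@ell2_limit_bound _ u l y _ n) => //.
    by rewrite addr_ge0 // ltW.
  exact: near_u.
have ls : square_summable l.
  have -> : l = (fun k => u 0%N k + -1 * (u 0%N k - l k)).
    by apply/funext => k; rewrite mulN1r opprB addrC subrK.
  apply: square_summableD; first exact: coord_summable.
  by apply: square_summableZ; exists ((d 0%N + d 0%N) ^+ 2); exact: bound.
apply/cvg_ex; exists (Ell2 ls); apply/cvg_ballP => e e0.
have er : (complex.Re e)%:C = e by rewrite RRe_real // gtr0_real.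
have [|n ne] := small (complex.Re e / 2).
  by rewrite divr_gt0 // -(ltcR 0) er.
apply: filterS (uF n) => y; rewrite -!ball_normE /= => uy.
rewrite (le_lt_trans (ler_distD (u n) _ _)) // -er [complex.Re e]splitr.
rewrite rmorphD /= ltrD //; last first.
  rewrite (lt_trans uy) // ltcR (le_lt_trans _ ne) //.
  by rewrite lerDl ltW.
rewrite (@le_lt_trans _ _ (d n + d n)%:C) ?ltcR //.
rewrite distrC; apply/ell2_norm_le; first by rewrite addr_ge0 // ltW.
move=> N; have := bound n _ (uF n) N; congr (_ <= _); congr (series _ N).
by apply/funext => k; rewrite coordB.
Qed.

HB.instance Definition _ := Uniform_isComplete.Build (ell2 R) ell2_complete.

HB.instance Definition _ := isHilbert.Build R (ell2 R)
  (@ell2_dotDl R) (@ell2_dotZl R) (@ell2_dot_conj R)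
  (fun x => esym (ell2_normE x)).

Lemma ell2_innerP x y : ccvg (dotsum x y) (inner x y).
Proof. exact: ell2_dotP. Qed.

End Ell2Complete.

(** * The standard basis, and pushing sequences along an increasing map *)

Section Ell2Basis.
Variable R : realType.
Implicit Types (x y z : ell2 R) (c : R[i]).

Let basis_fun (p k : nat) : R[i] := (k == p)%:R.

Lemma basis_fun_summable p : square_summable (basis_fun p).
Proof.
exists 1 => n; suff -> : sqsum (basis_fun p) n = (p < n)%N%:R by rewrite lern1 leq_b1.
rewrite /sqsum; elim: n => [|n IH]; first by rewrite /series /= big_geq.
rewrite seriesSr IH /basis_fun ltnS; have [->|np] := eqVneq n p.
  by rewrite ltnn leqnn /sqc /= expr1n expr0n addr0 add0r.
by rewrite [(p <= n)%N]leq_eqVlt [p == n]eq_sym (negbTE np) /sqc /= expr0n !addr0.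
Qed.

Definition ebasis p : ell2 R := Ell2 (basis_fun_summable p).

Lemma ebasisE p k : ebasis p k = (k == p)%:R.
Proof. by []. Qed.

Lemma inner_ebasis x p : inner x (ebasis p) = x p.
Proof.
have dotE n : dotsum x (ebasis p) n = (p < n)%N%:R * x p.
  rewrite /dotsum; elim: n => [|n IH]; first by rewrite /series /= big_geq // mul0r.
  rewrite seriesSr IH ebasisE ltnS conjC_nat; have [->|np] := eqVneq n p.
    by rewrite ltnn leqnn mul0r add0r mulr1 mul1r.
  by rewrite mulr0 addr0 [(p <= n)%N]leq_eqVlt [p == n]eq_sym (negbTE np).
have : ccvg (fun n => dotsum x (ebasis p) (n + p.+1)%N) (inner x (ebasis p)).
  by apply: (@ccvg_comp _ _ _ (addn^~ p.+1)); [exact: cvg_addnr|exact: ell2_innerP].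
move=> /ccvg_lim <-; apply: ccvg_lim.
have -> : (fun n => dotsum x (ebasis p) (n + p.+1)%N) = fun=> x p.
  by apply/funext => n; rewrite dotE addnS ltnS leq_addl mul1r.
by split; exact: cvg_cst.
Qed.

Lemma ebasis_orthonormal : orthonormal_family ebasis.
Proof. by move=> i j; rewrite inner_ebasis ebasisE eq_sym. Qed.

Definition truncate x N : ell2 R := \sum_(k < N) x k *: ebasis k.

Lemma truncate_coord x N k : truncate x N k = if (k < N)%N then x k else 0.
Proof.
rewrite coord_sum; have [kN|Nk] := ltnP k N.
  rewrite (bigD1 (Ordinal kN)) //= big1 ?addr0 ?[basis_fun _ _]/basis_fun ?eqxx ?mulr1 // => i.
  by rewrite -val_eqE /= eq_sym => /negbTE ki; rewrite /basis_fun ki mulr0.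
rewrite big1 // => i _; rewrite coordZ ebasisE.
by rewrite gtn_eqF ?mulr0 // (leq_trans (ltn_ord i)).
Qed.

(** The squared norm of the remainder is the tail of the convergent sum of the
    squared moduli. *)
Lemma truncate_near x (e : R) : 0 < e ->
  exists N, rnorm (x - truncate x N) < e.
Proof.
move=> e0; pose L := limn (sqsum x).
have e2 : 0 < e / 2 by rewrite divr_gt0.
have e22 : 0 < (e / 2) ^+ 2 by rewrite exprn_gt0.
have /cvgrPdist_lt/(_ _ e22)[N _ LN] := sqsum_cvg (coord_summable x).
exists N; have := LN N (leqnn N) => /=.
rewrite ger0_norm ?subr_ge0; last first.
  by apply: sqsum_le_lim; exact: coord_summable.
move=> Le; apply: (@le_lt_trans _ _ (e / 2)); last first.
  by rewrite ltr_pdivrMr // ltr_pMr // ltr1n.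
rewrite -lecR -rnormE; apply/ell2_norm_le; first exact: ltW.
move=> n; apply: le_trans (ltW Le).
suff -> : sqsum (x - truncate x N) n = sqsum x (maxn n N) - sqsum x N.
  by rewrite lerD2r; apply: sqsum_le_lim; exact: coord_summable.
elim: n => [|n IH].
  by rewrite max0n subrr /sqsum /series /= big_geq.
rewrite /sqsum seriesSr -/(sqsum _ n) IH coordB truncate_coord.
have [nN|Nn] := ltnP n N.
  rewrite (maxn_idPr nN) !subrr add0r.
  by rewrite /sqc /= expr0n addr0.
rewrite (maxn_idPl (leqW Nn)) subr0.
by rewrite /sqsum [in RHS]seriesSr addrAC.
Qed.

End Ell2Basis.

Section PushPull.
Variables (phi : nat -> nat).
Hypothesis phi_incr : {homo phi : k l / (k < l)%N}.

Lemma incr_ge k : (k <= phi k)%N.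
Proof. by elim: k => // k IH; rewrite (leq_ltn_trans IH) // phi_incr. Qed.

Lemma incr_inj : injective phi.
Proof.
by move=> k l kl; case: (ltngtP k l) => // h; have := phi_incr h; rewrite kl ltnn.
Qed.

Lemma incr_le k l : (k <= l)%N -> (phi k <= phi l)%N.
Proof.
by rewrite leq_eqVlt => /orP[/eqP ->//|h]; rewrite ltnW // phi_incr.
Qed.

Lemma incr_cvg : phi @ \oo --> \oo.
Proof.
move=> A [N _ NA]; exists N => // n /= Nn.
by apply: NA => /=; rewrite (leq_trans Nn) // incr_ge.
Qed.

Section Push.
Variable V : nmodType.
Implicit Type x : nat -> V.

(** The sequence carried by phi: its value at phi k is x k, and it vanishes off the
    image of phi.  As k <= phi k, only indices up to y can be sent to y, so a
    finite sum expresses it without choosing preimages. *)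
Definition push x (y : nat) : V := \sum_(k < y.+1 | phi k == y) x k.

Lemma push_image x k : push x (phi k) = x k.
Proof.
have kl : (k < (phi k).+1)%N by rewrite ltnS incr_ge.
rewrite /push (bigD1 (Ordinal kl)) //= big1 ?addr0 // => i /andP[/eqP/incr_inj ik].
by rewrite -val_eqE /= ik eqxx.
Qed.

Lemma push_outside x y : (forall k, phi k != y) -> push x y = 0.
Proof. by move=> ky; rewrite /push big_pred0 // => k; rewrite (negbTE (ky k)). Qed.

Lemma image_dichotomy y : (exists k, phi k = y) \/ (forall k, phi k != y).
Proof.
have [ky|ky] := pselect (exists k, phi k = y); [by left|right => k].
by apply/eqP => kl; apply: ky; exists k.
Qed.
End Push.

(** Between phi N and phi (N + 1) only the index phi N is hit, so partial sums up to
    phi N are partial sums of x up to N.  All reindexing of infinite sums below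
    is done along these indices. *)
Lemma series_push (V : zmodType) (x : nat -> V) N :
  series (push x) (phi N) = series x N.
Proof.
rewrite /series /=; elim: N => [|N IH].
  rewrite [RHS]big_geq // big_nat big1 // => y yl; apply: push_outside => k.
  by rewrite gtn_eqF // (leq_trans yl) // incr_le.
rewrite (@big_cat_nat _ _ _ (phi N)) //=; last by rewrite ltnW // phi_incr.
rewrite IH [RHS]big_nat_recr //=; congr (_ + _).
rewrite big_ltn ?phi_incr // push_image big_nat big1 ?addr0 // => y /andP[Ny yN].
apply: push_outside => k; have [kN|Nk] := leqP k N.
  by rewrite ltn_eqF // (leq_ltn_trans _ Ny) // incr_le.
by rewrite gtn_eqF // (leq_trans yN) // incr_le.
Qed.

End PushPull.

(** * The C*-algebra of bounded operators *)

(** An operator is stored with its adjoint, which is unique, so that the star is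
    an exchange of fields; linearity follows from the adjoint relation.  The
    proof that H is nonzero belongs to the type because the algebra must
    satisfy 1 != 0. *)
Record boundedop (R : realType) (H : hilbertType R) (H0 : exists x : H, x != 0) :=
  BoundedOp {
  bop :> H -> H;
  bop_adj : H -> H;
  bop_adjP : forall x y, inner (bop x) y = inner x (bop_adj y);
  bop_bounded : exists M : R, forall x, rnorm (bop x) <= M * rnorm x
}.

HB.instance Definition _ (R : realType) (H : hilbertType R)
  (H0 : exists x : H, x != 0) := gen_eqMixin (boundedop H0).
HB.instance Definition _ (R : realType) (H : hilbertType R)
  (H0 : exists x : H, x != 0) := gen_choiceMixin (boundedop H0).

Section BoundedOperators.
Variables (R : realType) (H : hilbertType R) (H0 : exists x : H, x != 0).
Local Notation B := (boundedop H0).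
Implicit Types (T S : B) (x y : H) (c : R[i]).

Lemma bop_eq T S : bop T =1 bop S -> T = S.
Proof.
case: T S => [t t' ta tb] [s s' sa sb] /= /funext ts; move: ta tb sa sb.
rewrite ts => ta tb sa sb; have ts' : t' = s'.
  apply/funext => y; apply: inner_inj => z.
  by rewrite inner_conj -ta sa -inner_conj.
move: ta; rewrite ts' => ta.
by rewrite (Prop_irrelevance ta sa) (Prop_irrelevance tb sb).
Qed.

Lemma bopD T x y : T (x + y) = T x + T y.
Proof. by apply: inner_inj => z; rewrite innerDl !bop_adjP innerDl. Qed.

Lemma bopZ T c x : T (c *: x) = c *: T x.
Proof. by apply: inner_inj => z; rewrite innerZl !bop_adjP innerZl. Qed.

Lemma bop0 T : T 0 = 0.
Proof. by rewrite -(scale0r 0) bopZ !scale0r. Qed.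

Lemma bopB T x y : T (x - y) = T x - T y.
Proof. by rewrite bopD -scaleN1r bopZ scaleN1r. Qed.

Lemma bop_adj_inner T x y : inner (bop_adj T x) y = inner x (T y).
Proof. by rewrite inner_conj -bop_adjP -inner_conj. Qed.

(** |t' y|^2 = <t (t' y), y> <= M |t' y| |y|; cancel one factor |t' y|. *)
Lemma rnorm_adj_le (t t' : H -> H) (M : R) :
  (forall x y, inner (t x) y = inner x (t' y)) -> 0 <= M ->
  (forall x, rnorm (t x) <= M * rnorm x) ->
  forall y, rnorm (t' y) <= M * rnorm y.
Proof.
move=> ta M0 tM y.
have [->|t'y] := eqVneq (rnorm (t' y)) 0; first by rewrite mulr_ge0 // rnorm_ge0.
have t'y0 : 0 < rnorm (t' y) by rewrite lt0r t'y rnorm_ge0.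
rewrite -(ler_pM2r t'y0) -expr2.
have -> : rnorm (t' y) ^+ 2 = complex.Re `|inner (t (t' y)) y|.
  rewrite ta inner_rnorm normc_def /= expr0n addr0 sqrtr_sqr ger0_norm //.
  by rewrite exprn_ge0 // rnorm_ge0.
rewrite (le_trans (inner_cauchy_schwarz_rnorm _ _)) // mulrAC.
by rewrite ler_wpM2r // rnorm_ge0.
Qed.

Definition opbound T : set R :=
  [set M : R | 0 <= M /\ forall x, rnorm (T x) <= M * rnorm x].

Definition opnorm T : R := inf (opbound T).

Lemma opbound_has_inf T : has_inf (opbound T).
Proof.
split; last by exists 0 => M [].
have [M TM] := bop_bounded T; exists `|M|; split => // x.
by rewrite (le_trans (TM x)) // ler_wpM2r ?rnorm_ge0 // ler_norm.
Qed.

Lemma opnorm_le T M : 0 <= M -> (forall x, rnorm (T x) <= M * rnorm x) ->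
  opnorm T <= M.
Proof. by move=> M0 TM; apply: ge_inf => //; case: (opbound_has_inf T). Qed.

Lemma opnorm_ge0 T : 0 <= opnorm T.
Proof. by apply: lb_le_inf; [case: (opbound_has_inf T)|move=> M []]. Qed.

Lemma rnorm_bop T x : rnorm (T x) <= opnorm T * rnorm x.
Proof.
have [x0|x0] := eqVneq (rnorm x) 0.
  by rewrite (rnorm_eq0 x0) bop0 rnorm0 mulr0.
have xgt0 : 0 < rnorm x by rewrite lt0r x0 rnorm_ge0.
rewrite -ler_pdivrMr //; apply: lb_le_inf; first by case: (opbound_has_inf T).
by move=> M [M0 TM]; rewrite ler_pdivrMr.
Qed.

Program Definition bop_zero : B := @BoundedOp _ _ H0 (fun=> 0) (fun=> 0) _ _.
Next Obligation. by move=> x y /=; rewrite inner0l inner0r. Qed.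
Next Obligation. by move=> *; exists 0 => x; rewrite rnorm0 mul0r. Qed.

Program Definition bop_one : B := @BoundedOp _ _ H0 id id _ _.
Next Obligation. by []. Qed.
Next Obligation. by move=> *; exists 1 => x; rewrite mul1r. Qed.

Program Definition bop_add T S : B := @BoundedOp _ _ H0
  (fun x => T x + S x) (fun x => bop_adj T x + bop_adj S x) _ _.
Next Obligation. by move=> * /=; rewrite innerDl innerDr !bop_adjP. Qed.
Next Obligation.
move=> T S; exists (opnorm T + opnorm S) => x /=; rewrite mulrDl.
by rewrite (le_trans (rnorm_triangle _ _)) // lerD // rnorm_bop.
Qed.

Program Definition bop_scale c T : B := @BoundedOp _ _ H0
  (fun x => c *: T x) (fun x => Num.conj c *: bop_adj T x) _ _.
Next Obligation. by move=> * /=; rewrite innerZl innerZr bop_adjP conjCK. Qed.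
Next Obligation.
move=> c T; exists (complex.Re `|c| * opnorm T) => x /=; rewrite rnormZ -mulrA.
by rewrite ler_wpM2l ?rnorm_bop // -ler0c RRe_real ?normr_real.
Qed.

Program Definition bop_mul T S : B := @BoundedOp _ _ H0
  (fun x => T (S x)) (fun x => bop_adj S (bop_adj T x)) _ _.
Next Obligation. by move=> * /=; rewrite !bop_adjP. Qed.
Next Obligation.
move=> T S; exists (opnorm T * opnorm S) => x /=; rewrite (le_trans (rnorm_bop _ _)) // -mulrA.
by rewrite ler_wpM2l ?rnorm_bop // opnorm_ge0.
Qed.

Program Definition bop_star T : B := @BoundedOp _ _ H0 (bop_adj T) (bop T) _ _.
Next Obligation. move=> *; exact: bop_adj_inner. Qed.
Next Obligation.
move=> T; exists (opnorm T); apply: rnorm_adj_le (opnorm_ge0 T) (rnorm_bop T).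
exact: bop_adjP.
Qed.

Let addA : associative bop_add.
Proof. by move=> T S U; apply: bop_eq => x /=; rewrite addrA. Qed.
Let addC : commutative bop_add.
Proof. by move=> T S; apply: bop_eq => x /=; rewrite addrC. Qed.
Let add0 : left_id bop_zero bop_add.
Proof. by move=> T; apply: bop_eq => x /=; rewrite add0r. Qed.
Let addN : left_inverse bop_zero (bop_scale (-1)) bop_add.
Proof. by move=> T; apply: bop_eq => x /=; rewrite scaleN1r addNr. Qed.

HB.instance Definition _ := GRing.isZmodule.Build B addA addC add0 addN.

Let mulA : associative bop_mul.
Proof. by move=> T S U; apply: bop_eq. Qed.
Let mul1 : left_id bop_one bop_mul.
Proof. by move=> T; apply: bop_eq. Qed.
Let mulr_one : right_id bop_one bop_mul.
Proof. by move=> T; apply: bop_eq. Qed.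
Let mulDl : left_distributive bop_mul +%R.
Proof. by move=> T S U; apply: bop_eq. Qed.
Let mulDr : right_distributive bop_mul +%R.
Proof. by move=> T S U; apply: bop_eq => x /=; rewrite bopD. Qed.
Let one_neq0 : bop_one != 0.
Proof.
have [x x0] := H0; apply/eqP => /(congr1 (fun T : B => T x)) /= x0'.
by rewrite x0' eqxx in x0.
Qed.

HB.instance Definition _ :=
  GRing.Zmodule_isNzRing.Build B mulA mul1 mulr_one mulDl mulDr one_neq0.

Let scaleA c d T : bop_scale c (bop_scale d T) = bop_scale (c * d) T.
Proof. by apply: bop_eq => x /=; rewrite scalerA. Qed.
Let scale1 : left_id 1 bop_scale.
Proof. by move=> T; apply: bop_eq => x /=; rewrite scale1r. Qed.
Let scaleDr : right_distributive bop_scale +%R.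
Proof. by move=> c T S; apply: bop_eq => x /=; rewrite scalerDr. Qed.
Let scaleDl T : {morph bop_scale^~ T : c d / c + d}.
Proof. by move=> c d; apply: bop_eq => x /=; rewrite scalerDl. Qed.

HB.instance Definition _ :=
  GRing.Zmodule_isLmodule.Build R[i] B scaleA scale1 scaleDr scaleDl.

Let scaleAl c T S : c *: (T * S) = (c *: T) * S.
Proof. by apply: bop_eq. Qed.
HB.instance Definition _ := GRing.Lmodule_isLalgebra.Build R[i] B scaleAl.

Let scaleAr c T S : c *: (T * S) = T * (c *: S).
Proof. by apply: bop_eq => x /=; rewrite bopZ. Qed.
HB.instance Definition _ := GRing.Lalgebra_isAlgebra.Build R[i] B scaleAr.

Lemma bop_sub T S x : (T - S) x = T x - S x.
Proof. by rewrite /= scaleN1r. Qed.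

Lemma bop_sum (I : Type) (r : seq I) (P : pred I) (F : I -> B) x :
  (\sum_(i <- r | P i) F i) x = \sum_(i <- r | P i) F i x.
Proof. by apply: (big_morph (fun T : B => T x)). Qed.

Let opnorm_triangle T S : opnorm (T + S) <= opnorm T + opnorm S.
Proof.
apply: opnorm_le => [|x]; first by rewrite addr_ge0 // opnorm_ge0.
by rewrite mulrDl (le_trans (rnorm_triangle _ _)) // lerD // rnorm_bop.
Qed.

Let opnormZ_le c T : opnorm (c *: T) <= complex.Re `|c| * opnorm T.
Proof.
have c0 : 0 <= complex.Re `|c| by rewrite -ler0c RRe_real ?normr_real.
apply: opnorm_le => [|x]; first by rewrite mulr_ge0 // opnorm_ge0.
by rewrite rnormZ -mulrA ler_wpM2l // rnorm_bop.
Qed.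

Let opnormZ c T : (opnorm (c *: T))%:C = `|c| * (opnorm T)%:C.
Proof.
have cE : `|c| = (complex.Re `|c|)%:C by rewrite RRe_real // normr_real.
rewrite cE -rmorphM; congr (_%:C); apply/eqP; rewrite eq_le opnormZ_le andTb.
have [->|c0] := eqVneq c 0; first by rewrite normr0 mul0r opnorm_ge0.
have nc0 : 0 < complex.Re `|c| by rewrite -(ltcR 0) -cE normr_gt0.
rewrite -ler_pdivlMl //; have := opnormZ_le c^-1 (c *: T).
rewrite scalerA mulVf // scale1r => /le_trans; apply.
rewrite ler_wpM2r ?opnorm_ge0 // -lecR RRe_real ?normr_real //.
by rewrite normfV cE fmorphV.
Qed.

Let opnorm_eq0 T : opnorm T = 0 -> T = 0.
Proof.
move=> T0; apply: bop_eq => x; apply: rnorm_eq0; apply/eqP.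
by rewrite eq_le rnorm_ge0 andbT (le_trans (rnorm_bop _ _)) // T0 mul0r.
Qed.

Let opnormM T S : opnorm (T * S) <= opnorm T * opnorm S.
Proof.
apply: opnorm_le => [|x]; first by rewrite mulr_ge0 // opnorm_ge0.
apply: (le_trans (rnorm_bop T (S x))); rewrite -mulrA.
by rewrite ler_wpM2l ?rnorm_bop // opnorm_ge0.
Qed.

Let opnorm_star_le T : opnorm (bop_star T) <= opnorm T.
Proof.
apply: (opnorm_le (opnorm_ge0 T)); apply: rnorm_adj_le (opnorm_ge0 T) (rnorm_bop T).
exact: bop_adjP.
Qed.

Let opnorm_cstar T : opnorm (bop_star T * T) = opnorm T ^+ 2.
Proof.
apply/eqP; rewrite eq_le; apply/andP; split.
  rewrite (le_trans (opnormM _ _)) // expr2 ler_wpM2r ?opnorm_ge0 //.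
have n0 : 0 <= opnorm (bop_star T * T) by exact: opnorm_ge0.
(* |T x|^2 = <T^* T x, x> shows that the root of the norm of T^* T bounds T *)
rewrite -[leRHS]sqr_sqrtr // ler_sqr ?nnegrE ?sqrtr_ge0 ?opnorm_ge0 //.
apply: opnorm_le => [|x]; first exact: sqrtr_ge0.
rewrite -ler_sqr ?nnegrE ?mulr_ge0 ?sqrtr_ge0 ?rnorm_ge0 //.
rewrite exprMn sqr_sqrtr //.
have -> : rnorm (T x) ^+ 2 = complex.Re `|inner (bop_adj T (T x)) x|.
  rewrite bop_adj_inner inner_rnorm normc_def /= expr0n addr0 sqrtr_sqr ger0_norm //.
  by rewrite exprn_ge0 // rnorm_ge0.
rewrite (le_trans (inner_cauchy_schwarz_rnorm _ _)) // expr2 mulrA.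
by rewrite ler_wpM2r ?rnorm_ge0 // (rnorm_bop (bop_star T * T)).
Qed.

Let opnorm_complete (u : nat -> B) :
  (forall e : R, 0 < e -> exists N : nat, forall m n : nat,
     (N <= m)%N -> (N <= n)%N -> opnorm (u m - u n) < e) ->
  exists l : B, forall e : R, 0 < e -> exists N : nat, forall n : nat,
      (N <= n)%N -> opnorm (u n - l) < e.
Proof.
move=> uC.
(* An operator Cauchy sequence has a pointwise limit, reached uniformly on
   bounded sets; this is used for the operators and for their adjoints. *)
have limit (t : nat -> B) : (forall e : R, 0 < e -> exists N, forall m n : nat,
     (N <= m)%N -> (N <= n)%N -> opnorm (t m - t n) < e) ->
    exists l : H -> H, forall e : R, 0 < e -> exists N, forall n : nat,
      (N <= n)%N -> forall x, rnorm (t n x - l x) <= e * rnorm x.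
  move=> tC.
  have dist m n x : rnorm (t m x - t n x) <= opnorm (t m - t n) * rnorm x.
    by rewrite -bop_sub rnorm_bop.
  have /choice[l tl] : forall x, exists y, forall e : R, 0 < e ->
      exists N, forall n : nat, (N <= n)%N -> rnorm (t n x - y) < e.
    move=> x; apply: seq_complete => e e0.
    have x1 : 0 < rnorm x + 1 by rewrite ltr_wpDl // rnorm_ge0.
    have [N tN] := tC _ (divr_gt0 e0 x1); exists N => m n Nm Nn.
    rewrite (le_lt_trans (dist _ _ _)) //.
    have := tN _ _ Nm Nn; rewrite ltr_pdivlMr //; apply: le_lt_trans.
    by rewrite ler_wpM2l ?opnorm_ge0 // lerDl.
  exists l => e /tC[N tN]; exists N => n Nn x; apply/ler_addgt0Pr => d d0.
  have [M tM] := tl x d d0.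
  pose m := maxn N M.
  rewrite -(subrKA (t m x)) (le_trans (rnorm_triangle _ _)) // lerD //.
    rewrite (le_trans (dist _ _ _)) // ler_wpM2r ?rnorm_ge0 // ltW //.
    by rewrite tN // leq_maxl.
  by rewrite ltW // tM // leq_maxr.
have [l ul] := limit u uC.
have [l' ul'] : exists l' : H -> H, forall e : R, 0 < e -> exists N,
    forall n : nat, (N <= n)%N -> forall x, rnorm (bop_star (u n) x - l' x) <= e * rnorm x.
  apply: limit => e /uC[N uN]; exists N => m n Nm Nn.
  apply: le_lt_trans (uN _ _ Nm Nn).
  have -> : bop_star (u m) - bop_star (u n) = bop_star (u m - u n).
    by apply: bop_eq => x /=; rewrite conjCN1.
  exact: opnorm_star_le.
(* <l x, y> - <x, l' y> is split at <u n x, y> = <x, u n^* y> *)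
have adj x y : inner (l x) y = inner x (l' y).
  apply/eqP; rewrite -subr_eq0 -normr_eq0; set D := `|_|.
  have Dr : (complex.Re D)%:C = D by rewrite RRe_real // normr_real.
  rewrite eq_le normr_ge0 andbT -Dr lecR; apply/ler_addgt0Pr => d d0; rewrite add0r.
  pose K := rnorm x * rnorm y.
  have K0 : 0 <= K by rewrite mulr_ge0 // rnorm_ge0.
  have e0 : 0 < d / (K + K + 1) by rewrite divr_gt0 // ltr_wpDl // addr_ge0.
  have [[N uN] [M uM]] := (ul _ e0, ul' _ e0).
  pose n := maxn N M.
  have {uN} uN := uN n (leq_maxl _ _) x.
  have {uM} uM := uM n (leq_maxr _ _) y.
  have -> : D = `|inner (l x - u n x) y + inner x (bop_star (u n) y - l' y)|.
    by rewrite innerBl innerBr -[inner x (bop_star _ _)]bop_adjP addrA subrK.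
  have le1 : complex.Re `|inner (l x - u n x) y| <= d / (K + K + 1) * K.
    rewrite (le_trans (inner_cauchy_schwarz_rnorm _ _)) // rnormB mulrA.
    by rewrite ler_wpM2r // rnorm_ge0.
  have le2 : complex.Re `|inner x (bop_star (u n) y - l' y)| <= d / (K + K + 1) * K.
    rewrite (le_trans (inner_cauchy_schwarz_rnorm _ _)) // mulrCA.
    by rewrite ler_wpM2l // rnorm_ge0.
  apply: (@le_trans _ _ (d / (K + K + 1) * K + d / (K + K + 1) * K)).
    by apply: le_trans (lerD le1 le2); apply: Re_normD.
  rewrite -mulrDr mulrAC ler_pdivrMr ?ltr_wpDl ?addr_ge0 //.
  by apply: ler_wpM2l; [exact: ltW|rewrite lerDl].
have [N lN] := ul 1 ltr01.
have bounded : exists M : R, forall x, rnorm (l x) <= M * rnorm x.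
  exists (opnorm (u N) + 1) => x.
  rewrite -[l x](subrK (u N x)) addrC (le_trans (rnorm_triangle _ _)) //.
  by rewrite mulrDl lerD ?rnorm_bop // rnormB lN.
exists (BoundedOp H0 adj bounded) => e e0.
have e20 : 0 < e / 2 by rewrite divr_gt0.
have [M lM] := ul _ e20; exists M => n Mn.
apply: (@le_lt_trans _ _ (e / 2)); last first.
  by rewrite ltr_pdivrMr // ltr_pMr // ltr1n.
by apply: opnorm_le => [|x]; [exact: ltW|rewrite bop_sub /= lM].
Qed.

Let starK : involutive bop_star. Proof. by move=> T; apply: bop_eq. Qed.
Let starD T S : bop_star (T + S) = bop_star T + bop_star S.
Proof. by apply: bop_eq. Qed.
Let starZ c T : bop_star (c *: T) = Num.conj c *: bop_star T.
Proof. by apply: bop_eq. Qed.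
Let starM T S : bop_star (T * S) = bop_star S * bop_star T.
Proof. by apply: bop_eq. Qed.

HB.instance Definition _ := isCStar.Build R B opnorm_triangle opnormZ opnorm_eq0
  opnormM opnorm_complete starK starD starZ starM opnorm_cstar.

End BoundedOperators.

(** * Representations and shift operators *)

Section BoundedOpRepresentation.
Variables (R : realType) (H : hilbertType R) (H0 : exists x : H, x != 0).

Let bop_linear (T : boundedop H0) : linear (bop T).
Proof. by move=> c x y; rewrite bopD bopZ. Qed.

HB.instance Definition _ (T : boundedop H0) :=
  GRing.isLinear.Build R[i] H H _ (bop T) (bop_linear T).

Lemma bop_continuous (T : boundedop H0) : continuous (bop T).
Proof.
move=> x; apply/cvgrPdist_lt => e e0.
have er : (complex.Re e)%:C = e by rewrite RRe_real // gtr0_real.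
have r0 : 0 < complex.Re e by rewrite -(ltcR 0) er.
have T1 : 0 < opnorm T + 1 by rewrite ltr_wpDl // opnorm_ge0.
have d0 : 0 < (complex.Re e / (opnorm T + 1))%:C by rewrite (ltcR 0) divr_gt0.
near=> y.
have : `|x - y| < (complex.Re e / (opnorm T + 1))%:C.
  near: y; exact: (@cvgr_dist_lt _ _ _ _ _ id x).
rewrite !rnormE -{2}er !ltcR ltr_pdivlMr // -bopB; apply: le_lt_trans.
by rewrite (le_trans (rnorm_bop _ _)) // mulrC ler_wpM2l ?rnorm_ge0 // lerDl.
Unshelve. all: by end_near. Qed.

(** The only analytic content is continuity of each operator; the rest restates
    that f is a morphism. *)
Program Definition hom_representation (A : cstarType R)
    (f : {lrmorphism A -> boundedop H0})
    (f_star : forall a, f (star a) = star (f a)) : representation A H :=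
  @Representation R A H (fun a => bop (f a)) _ _ _ _ _ _.
Next Obligation. by move=> *; apply: bop_continuous. Qed.
Next Obligation. by move=> * /=; rewrite rmorphD. Qed.
Next Obligation. by move=> * /=; rewrite linearZ. Qed.
Next Obligation. by move=> * /=; rewrite rmorphM. Qed.
Next Obligation. by move=> * /=; rewrite rmorph1. Qed.
Next Obligation. by move=> A f f_star a x y /=; rewrite f_star bop_adj_inner. Qed.

End BoundedOpRepresentation.

Section CuntzProjections.
Variables (R : realType) (A : cstarType R).

Lemma star0 : star (0 : A) = 0.
Proof. by rewrite -(scale0r 0) starZ conjC0 !scale0r. Qed.

Lemma star_sum (I : Type) (r : seq I) (P : pred I) (F : I -> A) :
  star (\sum_(i <- r | P i) F i) = \sum_(i <- r | P i) star (F i).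
Proof. exact: (big_morph (@star R A) (@starD R A) star0). Qed.

Lemma star1 : star (1 : A) = 1.
Proof. by rewrite -[LHS]mulr1 -{2}[1]starK -starM mulr1 starK. Qed.

Lemma starN (a : A) : star (- a) = - star a.
Proof. by rewrite -scaleN1r starZ conjCN1 scaleN1r. Qed.

(** The finite sums of range projections are projections P, and
    1 - P = (1 - P)^* (1 - P). *)
Lemma cuntz_complete_isometries (t : nat -> A) :
  (forall i j, star (t i) * t j = (i == j)%:R) ->
  forall k, cstar_le (\sum_(i < k) t i * star (t i)) 1.
Proof.
move=> tt k; set P := \sum_(i < k) _; exists (1 - P).
have PP : P * P = P.
  rewrite {1}/P mulr_suml; apply: eq_bigr => i _.
  rewrite /P mulr_sumr (bigD1 i) //= big1 ?addr0 => [|j ji].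
    by rewrite mulrA -(mulrA (t i)) tt eqxx mulr1.
  rewrite mulrA -(mulrA (t i)) tt; move: ji; rewrite -val_eqE /= eq_sym => /negbTE ->.
  by rewrite mulr0 mul0r.
have Ps : star P = P.
  by rewrite /P star_sum; apply: eq_bigr => i _; rewrite starM starK.
by rewrite starD starN star1 Ps mulrBl mul1r mulrBr mulr1 PP subrr subr0.
Qed.

End CuntzProjections.

Section ShiftOperator.
Variables (R : realType) (phi : nat -> nat).
Hypothesis phi_incr : {homo phi : k l / (k < l)%N}.

Lemma ell2_neq0 : exists x : ell2 R, x != 0.
Proof.
exists (ebasis R 0); apply/eqP => /(congr1 (fun x => coord x 0%N)).
by rewrite ebasisE coord0 eqxx => /eqP; rewrite oner_eq0.
Qed.

Lemma sqsum_push (x : nat -> R[i]) n : sqsum (push phi x) (phi n) = sqsum x n.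
Proof.
rewrite -[RHS](series_push phi_incr); congr (series _ _); apply/funext => y.
have [[k <-]|ky] := image_dichotomy phi y; first by rewrite !push_image.
by rewrite !push_outside // /sqc /= expr0n addr0.
Qed.

Lemma sqsum_push_le (x : nat -> R[i]) n : sqsum (push phi x) n <= sqsum x n.
Proof. by rewrite -[leRHS]sqsum_push; apply: sqsum_nd; apply: incr_ge. Qed.

Lemma sqsum_pull_le (x : nat -> R[i]) n : sqsum (x \o phi) n <= sqsum x (phi n).
Proof.
rewrite -[leLHS]sqsum_push; apply: ler_sum => y _.
have [[k <-]|ky] := image_dichotomy phi y; first by rewrite push_image.
by rewrite push_outside // [leLHS]/sqc /= expr0n addr0 sqc_ge0.
Qed.

Lemma push_summable (x : nat -> R[i]) :
  square_summable x -> square_summable (push phi x).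
Proof. by move=> [M xM]; exists M => n; apply: le_trans (xM n); exact: sqsum_push_le. Qed.

Lemma pull_summable (x : nat -> R[i]) :
  square_summable x -> square_summable (x \o phi).
Proof.
by move=> [M xM]; exists M => n; apply: le_trans (xM (phi n)); exact: sqsum_pull_le.
Qed.

Let spush (x : ell2 R) := Ell2 (push_summable (coord_summable x)).
Let spull (x : ell2 R) := Ell2 (pull_summable (coord_summable x)).

Lemma push_adj (x y : ell2 R) : inner (spush x) y = inner x (spull y).
Proof.
have dotE : (fun n => dotsum (spush x) y (phi n)) = dotsum x (spull y).
  apply/funext => n; rewrite -[RHS](series_push phi_incr).
  congr (series _ _); apply/funext => k /=.
  have [[l <-]|kl] := image_dichotomy phi k; first by rewrite !push_image.
  by rewrite !push_outside // mul0r.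
have := ccvg_comp (incr_cvg phi_incr) (ell2_innerP (spush x) y).
by rewrite dotE => /ccvg_lim <-; apply: esym; apply: ccvg_lim; exact: ell2_innerP.
Qed.

Lemma push_bounded : exists M : R, forall x, rnorm (spush x) <= M * rnorm x.
Proof.
exists 1 => x; rewrite mul1r -lecR -rnormE.
apply/ell2_norm_le; first exact: rnorm_ge0.
have /ell2_norm_le : `|x| <= (rnorm x)%:C by rewrite -rnormE.
move=> /(_ (rnorm_ge0 x)) xle n; apply: le_trans (xle n).
exact: sqsum_push_le.
Qed.

(** The isometry sending the basis vector at k to the one at phi k. *)
Definition shift : boundedop ell2_neq0 := BoundedOp ell2_neq0 push_adj push_bounded.

Lemma shiftE x k : shift x k = push phi x k. Proof. by []. Qed.
End ShiftOperator.

(** * Branching systems and Cuntz families *)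

(** The naturals as nodes of a tree whose edges are labelled by letters: every
    node has exactly one parent, except that 0 is its own parent along
    root_letter.  Monotonicity in k makes the shift operators available, and
    branch_gt makes every node reachable from 0. *)
Record branching (I : eqType) := Branching {
  branch :> I -> nat -> nat;
  branch_incr : forall i, {homo branch i : k l / (k < l)%N};
  branch_inj : forall i j k l, branch i k = branch j l -> i = j;
  branch_surj : forall y, exists i k, branch i k = y;
  root_letter : I;
  other_letter : I;
  letters_neq : other_letter != root_letter;
  branch_root : branch root_letter 0%N = 0%N;
  branch_gt : forall i k, branch i k != 0%N -> (k < branch i k)%N
}.

Section BranchingExistence.
Local Open Scope nat_scope.

(** Euclidean division by m: the letter is the last base-m digit. *)
Lemma finite_branching (m : nat) : 2 <= m -> inhabited (branching 'I_m).
Proof.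
move=> m2; have m0 : 0 < m by exact: ltnW.
constructor; apply: (@Branching 'I_m (fun i k => k * m + i) _ _ _
  (Ordinal m0) (Ordinal m2)) => //.
- by move=> i k l kl; rewrite ltn_add2r ltn_pmul2r.
- move=> i j k l /(congr1 (modn^~ m)).
  by rewrite /= !modnMDl !modn_small // => /val_inj.
- move=> y; exists (Ordinal (ltn_pmod y m0)), (y %/ m) => /=.
  by rewrite -divn_eq.
- move=> i k /=; nia.
Qed.

(** Every positive number is a power of 2 times an odd number, in one way; the
    exponent is the letter. *)
Lemma infinite_branching : inhabited (branching nat).
Proof.
have log_odd i k : logn 2 (2 ^ i * k.*2.+1) = i.
  rewrite lognM ?expn_gt0 // pfactorK //.
  by rewrite [X in i + X]logn_coprime ?addn0 // coprime2n /= odd_double.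
have pos i k : 0 < 2 ^ i * k.*2.+1 by rewrite muln_gt0 expn_gt0.
constructor; apply: (@Branching nat (fun i k => (2 ^ i * k.*2.+1).-1) _ _ _
  0 1) => //.
- move=> i k l kl; rewrite -ltnS !prednK // ltn_pmul2l ?expn_gt0 //.
  by rewrite ltnS ltn_double.
- move=> i j k l /(congr1 succn); rewrite !prednK // => /(congr1 (logn 2)).
  by rewrite !log_odd.
- move=> y; have [q + yq] := pfactor_coprime (isT : prime 2) (ltn0Sn y).
  rewrite coprime2n => qodd; exists (logn 2 y.+1), q./2.
  rewrite (_ : q./2.*2.+1 = q); last by rewrite -[RHS]odd_double_half qodd.
  by rewrite mulnC -yq.
- move=> i k; rewrite -lt0n -ltnS prednK // => h.
  rewrite -ltnS prednK //; have := expn_gt0 2 i; move: (2 ^ i) h => e.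
  rewrite -addnn; nia.
Qed.

End BranchingExistence.

Lemma cuntz_branching (n : option nat) :
  (if n is Some m then is_true (2 <= m)%N else True) ->
  inhabited (branching (cuntz_index n)).
Proof.
by case: n => [m|_]; [exact: finite_branching|exact: infinite_branching].
Qed.

Section BranchingCuntz.
Variables (R : realType) (I : eqType) (b : branching I).

Definition branch_shift (i : I) : boundedop (ell2_neq0 R) :=
  shift R (@branch_incr _ b i).

Lemma branch_push (V : nmodType) (x : nat -> V) i j k :
  push (b i) x (b j k) = if i == j then x k else 0.
Proof.
have [<-|ij] := eqVneq i j; first by rewrite push_image //; exact: branch_incr.
by rewrite push_outside // => l; apply: contra ij => /eqP/branch_inj/eqP.
Qed.

Lemma branch_shift_orthonormal i j :
  star (branch_shift i) * branch_shift j = (i == j)%:R.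
Proof.
apply: bop_eq => x; apply: ell2_eq => k.
rewrite [LHS](branch_push x j i k) eq_sym.
by case: eqP.
Qed.

Lemma branch_shift_ebasis i k :
  branch_shift i (ebasis R k) = ebasis R (b i k).
Proof.
apply: ell2_eq => y; rewrite shiftE ebasisE.
have [j [l <-]] := branch_surj b y; rewrite branch_push ebasisE.
have [<-|ij] := eqVneq i j.
  by rewrite (inj_eq (incr_inj (@branch_incr _ b i))).
by case: eqP => // /branch_inj ji; rewrite ji eqxx in ij.
Qed.

End BranchingCuntz.

Lemma branch_shift_cuntz_relations (R : realType) (n : option nat)
    (b : branching (cuntz_index n)) : cuntz_relations (branch_shift R b).
Proof.
split; first exact: branch_shift_orthonormal.
case: n b => [m|] b /=; last first.
  by apply: cuntz_complete_isometries; exact: branch_shift_orthonormal.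
apply: bop_eq => x; apply: ell2_eq => y.
rewrite bop_sum coord_sum; have [i [k <-]] := branch_surj b y.
rewrite (bigD1 i) //= big1 ?addr0 => [|j ji].
  by rewrite branch_push eqxx.
by rewrite branch_push (negbTE ji).
Qed.

(** * Vector states and their correlation dimension *)

Section VectorStates.
Variables (R : realType) (A : cstarType R) (H : hilbertType R).
Variable pi : representation A H.

Definition vector_functional (x : H) (a : A) : R[i] := inner (pi a x) x.

Let vector_functional_scalar x : scalar (vector_functional x).
Proof.
by move=> c a b; rewrite /vector_functional repD repZ innerDl innerZl.
Qed.

HB.instance Definition _ x :=
  GRing.isLinear.Build R[i] A R[i] _ (vector_functional x) (vector_functional_scalar x).

Lemma rep_inner a b x : inner (pi a x) (pi b x) = vector_functional x (star b * a).
Proof. by rewrite /vector_functional repM rep_star. Qed.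

Lemma vector_functional_ge0 x a : 0 <= vector_functional x (star a * a).
Proof. by rewrite -rep_inner inner_rnorm ler0c exprn_ge0 // rnorm_ge0. Qed.

Variables (x : H) (x1 : inner x x = 1).

Lemma vector_functional1 : vector_functional x 1 = 1.
Proof. by rewrite /vector_functional rep1. Qed.

Definition vector_state : state A :=
  @State R A (vector_functional x) (vector_functional_ge0 x) vector_functional1.

(** In every GNS triple the inner product of a Omega and b Omega is the value of
    the state at b^* a, hence agrees with the concrete representation. *)
Lemma gns_vector_inner (G : gns vector_state) a b :
  inner (gns_rep G a (gns_vector G)) (gns_rep G b (gns_vector G)) =
  inner (pi a x) (pi b x).
Proof. by rewrite rep_inner -rep_star -repM -gns_state. Qed.

(** The vector (a - c) Omega has the same norm in G as (a - c) x, which is zero. *)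
Lemma gns_vector_scale (G : gns vector_state) a c :
  pi a x = c *: x -> gns_rep G a (gns_vector G) = c *: gns_vector G.
Proof.
move=> ax; have pia : pi (a + (- c) *: 1) x = 0.
  by rewrite repD repZ rep1 ax scaleNr subrr.
have : inner (gns_rep G (a + (- c) *: 1) (gns_vector G))
             (gns_rep G (a + (- c) *: 1) (gns_vector G)) = 0.
  by rewrite gns_vector_inner pia inner0l.
move=> /inner_eq0/eqP.
by rewrite repD repZ rep1 scaleNr subr_eq0 => /eqP.
Qed.

Lemma gns_vector_unit (G : gns vector_state) :
  inner (gns_vector G) (gns_vector G) = 1.
Proof. by have := gns_state G 1; rewrite rep1 => <-; exact: vector_functional1. Qed.

Definition vector_gns (cyc : dense (range (fun a => pi a x))) : gns vector_state :=
  @Gns R A vector_state H pi x (fun=> erefl) cyc.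

Section CorrelationDimension.
Variables (I : Type) (s : I -> A).

Lemma corr_space_word (omega : state A) (G : gns omega) (J : seq I) (c : R[i]) :
  corr_space s G (c *: gns_rep G (star (word_prod s J)) (gns_vector G)).
Proof.
apply: subset_closure; exists 1%N, (fun=> c).
exists (fun=> gns_rep G (star (word_prod s J)) (gns_vector G)).
by rewrite big_ord1; split => // _; exists J.
Qed.

(** In every GNS triple the correlation space is the line through Omega.  The
    cyclicity hypothesis provides one GNS triple; without any, cdim would take
    its infinite default value. *)
Lemma cdim_eigenvector :
  dense (range (fun a => pi a x)) ->
  (forall J, exists c, pi (star (word_prod s J)) x = c *: x) ->
  (cdim s vector_state < +oo)%E.
Proof.
move=> cyc eig; rewrite /cdim; case: xgetP => [d _ [G ->]|].
  apply: (hilbert_dim_line (gns_vector_unit G)).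
    exists [::] => //; rewrite /word_prod big_nil star1.
    exact: rep1.
  move=> _ [J _ <-]; have [c Jc] := eig J; exists c.
  exact: gns_vector_scale.
by move=> /(_ (hilbert_dim (corr_space s (vector_gns cyc)))) []; exists (vector_gns cyc).
Qed.

(** Rescaled by the c k, the vectors s_{J k}^* Omega of any GNS triple form an
    orthonormal sequence in the correlation space. *)
Lemma cdim_infinite (J : nat -> seq I) (c : nat -> R[i]) (f : nat -> H) :
  orthonormal_family f -> (forall k, c k != 0) ->
  (forall k, pi (star (word_prod s (J k))) x = c k *: f k) ->
  cdim s vector_state = +oo%E.
Proof.
move=> of_ c0 Jf; rewrite /cdim; case: xgetP => // d _ [G ->].
apply: (@hilbert_dim_infinite _ _ _ (fun k => (c k)^-1 *:
    gns_rep G (star (word_prod s (J k))) (gns_vector G))).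
  move=> k l; rewrite innerZl innerZr gns_vector_inner !Jf innerZl innerZr of_.
  have [->|_] := eqVneq k l; last by rewrite /= !mulr0.
  have cl0 : Num.conj (c l) != 0 by rewrite conjC_eq0.
  by rewrite mulr1 fmorphV /= mulrCA mulKf ?c0 // mulVf.
by move=> k; exact: corr_space_word.
Qed.

End CorrelationDimension.
End VectorStates.

(** * The two equivalent states *)

Section SpreadVector.
Variables (R : realType) (I : eqType) (b : branching I).
Local Notation z := (root_letter b).
Local Notation o := (other_letter b).

Definition branch_word (J : seq I) (k : nat) : nat := foldr b k J.

Lemma branch_word_inj (J : seq I) : injective (branch_word J).
Proof.
elim: J => // i J IH k l /= kl; apply: IH.
exact: incr_inj (@branch_incr _ b i) _ _ kl.
Qed.

(** The node reached from 0 by k steps along other_letter; these are distinct. *)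
Definition node (k : nat) : nat := branch_word (nseq k o) 0.

Lemma nodeS k : node k.+1 = b o (node k). Proof. by []. Qed.

Lemma node_incr : {homo node : k l / (k < l)%N}.
Proof.
apply: homo_ltn => [? ? ?|k]; first exact: ltn_trans.
rewrite nodeS; apply: branch_gt; apply/eqP; rewrite -(branch_root b).
by move=> /branch_inj zo; have := letters_neq b; rewrite zo eqxx.
Qed.

(** Words of the form o...oz.  No two of them are comparable as prefixes, so the
    corresponding isometries have orthogonal ranges. *)
Definition probe_word (k : nat) : seq I := rcons (nseq k o) z.

Lemma probe_word_inj k l y y' :
  branch_word (probe_word k) y = branch_word (probe_word l) y' -> k = l.
Proof.
have zo : forall p q, b z p <> b o q.
  by move=> p q /branch_inj zo; have := letters_neq b; rewrite zo eqxx.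
elim: k l => [|k IH] [|l] //= h; [by have := zo _ _ h|by have := zo _ _ (esym h)|].
by congr succn; apply: IH; apply: incr_inj (@branch_incr _ b o) _ _ h.
Qed.

(** Supported on the images of node k under probe_word k, so that applying the
    adjoint of the isometry of probe_word k isolates a multiple of the basis
    vector at node k.  The weight depends on the coordinate y rather than on k,
    which makes square-summability a geometric bound. *)
Definition spread_fun (y : nat) : R[i] :=
  if `[< exists k, y = branch_word (probe_word k) (node k) >] then (2^-1 ^+ y)%:C else 0.

Lemma spread_probe_word k y :
  spread_fun (branch_word (probe_word k) y) =
  (2^-1 ^+ branch_word (probe_word k) (node k))%:C * (y == node k)%:R.
Proof.
rewrite /spread_fun; case: asboolP => [[l h]|ky].
  have kl := probe_word_inj h; subst l.
  by rewrite (branch_word_inj h) eqxx mulr1.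
have [yk|] := eqVneq y (node k); last by rewrite mulr0.
by case: ky; exists k; rewrite yk.
Qed.

Lemma spread_summable : square_summable spread_fun.
Proof.
exists 2 => n; apply: (@le_trans _ _ (2 - 2 * 2^-1 ^+ n)); last first.
  by rewrite gerBl mulr_ge0 // exprn_ge0 // invr_ge0.
rewrite /sqsum; elim: n => [|n IH].
  by rewrite /series /= big_geq // expr0 mulr1 subrr.
rewrite seriesSr (le_trans (lerD IH (_ : _ <= 2^-1 ^+ n))) //; last first.
  rewrite exprS mulrA mulfV ?mul1r ?pnatr_eq0 //.
  by rewrite mulr_natl mulr2n opprD addrA subrK.
have h0 : 0 <= 2^-1 ^+ n :> R by rewrite exprn_ge0 // invr_ge0.
have h1 : 2^-1 ^+ n <= 1 :> R.
  by rewrite exprn_ile1 ?invr_ge0 // invf_le1 ?ler1n.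
rewrite /spread_fun; case: asboolP => _; rewrite /sqc /= expr0n addr0 ?expr0n //.
by rewrite expr2 -[leRHS]mulr1 ler_wpM2l.
Qed.

Definition spread : ell2 R := Ell2 spread_summable.

Lemma spread_neq0 : spread != 0.
Proof.
apply/eqP => /(congr1 (fun x => coord x (branch_word (probe_word 0) (node 0)))).
rewrite coord0 [LHS]spread_probe_word eqxx mulr1 => /complexI/eqP.
by rewrite expf_eq0 invr_eq0 pnatr_eq0 andbF.
Qed.

End SpreadVector.

Section PermutativeRepresentation.
Variables (R : realType) (I : eqType) (b : branching I) (A : cstarType R).
Variables (s : I -> A) (pi : representation A (ell2 R)).
Hypothesis pi_ebasis : forall i k, pi (s i) (ebasis R k) = ebasis R (b i k).
Hypothesis pi_star : forall i x k, pi (star (s i)) x k = x (b i k).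

Lemma pi_word_star J x k :
  pi (star (word_prod s J)) x k = x (branch_word b J k).
Proof.
elim: J x => [|i J IH] x; first by rewrite /word_prod big_nil star1 rep1.
by rewrite /word_prod big_cons starM repM [LHS]IH pi_star.
Qed.

(** Descent on y: the parent of a nonzero node is smaller. *)
Lemma ebasis_reached y : exists a, pi a (ebasis R 0) = ebasis R y.
Proof.
elim/ltn_ind: y => y IH; have [->|y0] := eqVneq y 0%N.
  by exists 1; rewrite rep1.
have [i [k yE]] := branch_surj b y.
have [|a ak] := IH k; first by rewrite -yE branch_gt // yE.
by exists (s i * a); rewrite repM ak pi_ebasis yE.
Qed.

Lemma rep_sum (J : Type) (r : seq J) (P : pred J) (F : J -> A) x :
  pi (\sum_(j <- r | P j) F j) x = \sum_(j <- r | P j) pi (F j) x.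
Proof.
apply: (big_morph (fun a => pi a x) (fun a c => repD pi a c x)).
by rewrite -(scale0r 0) repZ scale0r.
Qed.

Lemma ebasis0_cyclic : dense (range (fun a => pi a (ebasis R 0))).
Proof.
apply: dense_rnorm => x e /(truncate_near x)[N xN].
have /choice[a ak] := ebasis_reached.
exists (truncate x N) => //; exists (\sum_(k < N) x k *: a k) => //.
by rewrite rep_sum; apply: eq_bigr => k _; rewrite repZ ak.
Qed.

Lemma cyclic_from (x y : ell2 R) :
  dense (range (fun a => pi a x)) -> (exists a, pi a y = x) ->
  dense (range (fun a => pi a y)).
Proof.
move=> cyc [c cy] O O0 Oo; have [w [Ow [a _ aw]]] := cyc O O0 Oo.
by exists w; split => //; exists (a * c) => //; rewrite repM cy.
Qed.

(** Along any word a node does not decrease, so the only node that can be sent to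
    0 is 0 itself. *)
Lemma ebasis0_eigen J : exists c, pi (star (word_prod s J)) (ebasis R 0) = c *: ebasis R 0.
Proof.
exists (branch_word b J 0 == 0%N)%:R; apply: ell2_eq => k.
rewrite pi_word_star coordZ !ebasisE.
have [->|k0] := eqVneq k 0%N; first by rewrite mulr1.
rewrite mulr0; case: eqP => // Jk0.
have : (k <= branch_word b J k)%N.
  by elim: J {Jk0} => //= i J IH; rewrite (leq_trans IH) // incr_ge //; exact: branch_incr.
by rewrite Jk0 leqn0 (negbTE k0).
Qed.

Let nu : R[i] := (rnorm (spread R b))%:C^-1.
Definition spread_unit : ell2 R := nu *: spread R b.

Let nu_neq0 : nu != 0.
Proof.
rewrite invr_eq0; apply: contra (spread_neq0 R b) => /eqP/complexI/rnorm_eq0 ->.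
by [].
Qed.

Lemma spread_unit1 : inner spread_unit spread_unit = 1.
Proof.
have n0 : (rnorm (spread R b))%:C != 0 by rewrite -invr_eq0.
rewrite innerZl innerZr inner_rnorm.
have -> : Num.conj nu = nu.
  by rewrite conj_Creal // rpredV complex_real.
by rewrite /nu rmorphXn /= expr2 mulKf // mulVf.
Qed.

Let coef (k : nat) : R[i] :=
  nu * (2^-1 ^+ branch_word b (probe_word b k) (node b k))%:C.

Let coef_neq0 k : coef k != 0.
Proof.
rewrite mulf_neq0 //; apply/eqP => /complexI/eqP.
by rewrite expf_eq0 invr_eq0 pnatr_eq0 andbF.
Qed.

Lemma probe_spread k :
  pi (star (word_prod s (probe_word b k))) spread_unit = coef k *: ebasis R (node b k).
Proof.
apply: ell2_eq => y; rewrite pi_word_star !coordZ [X in nu * X]spread_probe_word.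
by rewrite mulrA.
Qed.

Lemma spread_unit_cyclic : dense (range (fun a => pi a spread_unit)).
Proof.
apply: (cyclic_from ebasis0_cyclic).
exists ((coef 0)^-1 *: star (word_prod s (probe_word b 0))).
by rewrite repZ probe_spread scalerA mulVf ?coef_neq0 // scale1r.
Qed.

(** The two vectors are cyclic in the same representation, so the identity
    intertwines the GNS representations of their states. *)
Lemma permutative_states :
  exists omega : state A,
    essentially_finitely_correlated s omega /\ ~ finitely_correlated s omega.
Proof.
have e1 : inner (ebasis R 0) (ebasis R 0) = 1.
  by rewrite ebasis_orthonormal eqxx.
exists (vector_state pi spread_unit1); split.
  have fin := cdim_eigenvector e1 ebasis0_cyclic ebasis0_eigen.
  apply: le_lt_trans fin; apply: ereal_inf_lbound.
  exists (vector_state pi e1) => //.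
  exists (vector_gns e1 ebasis0_cyclic), (vector_gns spread_unit1 spread_unit_cyclic).
  by exists idfun; split => // y _; exists y.
rewrite /finitely_correlated.
rewrite (@cdim_infinite _ _ _ _ _ spread_unit1 _ s (probe_word b) coef
  (fun k => ebasis R (node b k))) //.
  move=> k l; rewrite ebasis_orthonormal (inj_eq (incr_inj _)) //.
  exact: node_incr.
exact: probe_spread.
Qed.

End PermutativeRepresentation.

Theorem proposition3p20 (R : realType) (n : option nat)
    (hn : if n is Some m then is_true (2 <= m)%N else True)
    (A : cstarType R) (s : cuntz_index n -> A) (hA : is_cuntz_algebra s) :
  exists omega : state A,
    essentially_finitely_correlated s omega /\ ~ finitely_correlated s omega.
Proof.
have [b] := cuntz_branching hn.
have [_ _ /(_ _ _ (branch_shift_cuntz_relations R b)) [f [f_star f_s]]] := hA.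
apply: (@permutative_states R _ b A s (hom_representation f_star)) => [i k|i x k] /=.
  by rewrite f_s branch_shift_ebasis.
by rewrite f_star f_s.
Qed.
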